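(* Let $k\ge 3$ and let $G$ be a fair complete $k$-partite graph whose edges are coloured red and blue. Then the vertex set of $G$ can be partitioned into a red path and a blue path.
   Context: A complete $k$-partite graph has $k$ partition classes, all of which are assumed non-empty. A complete multipartite graph on $n$ vertices is called fair if no partition class contains more than $n/2$ vertices. A colouring of the edges is an arbitrary assignment of the colours red and blue to the edges (not necessarily proper). A monochromatic path of a given colour uses only edges of that colour; a path may be trivial (a single vertex) or empty, and a trivial or empty path counts as a path of either colour. ''Partitioned into'' means the two paths are vertex-disjoint and together cover all vertices. *)

(* Defs.v *)
From mathcomp Require Import all_boot.
Set Implicit Arguments. Unset Strict Implicit. Unset Printing Implicit Defensive.

(* A complete k-partite graph on vertex set T is given by a class map
   part : T -> 'I_k; x y adjacent iff part x != part y. *)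
Definition cmp_adj (T : finType) (k : nat) (part : T -> 'I_k) : rel T :=
  fun x y => part x != part y.

Definition classes_nonempty (T : finType) (k : nat) (part : T -> 'I_k) : Prop :=
  forall i : 'I_k, exists x : T, part x = i.

Definition fair (T : finType) (k : nat) (part : T -> 'I_k) : Prop :=
  forall i : 'I_k, 2 * #|[set x | part x == i]| <= #|T|.

(* A monochromatic path of colour c (true = red, false = blue) in the graph
   with adjacency adj under colouring col: a duplicate-free sequence of
   vertices, consecutive ones adjacent with an edge of colour c.
   The empty sequence and singletons are paths. *)
Definition mono_col_path (T : finType) (adj : rel T) (col : T -> T -> bool)
    (c : bool) (s : seq T) : bool :=
  uniq s && sorted (fun x y => adj x y && (col x y == c)) s.

(* Main.v *)
Require Import Defs.
From mathcomp Require Import all_boot zify.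
Set Implicit Arguments. Unset Strict Implicit. Unset Printing Implicit Defensive.

(** Merging classes reduces to three classes.  Let [R] be the complement of a
    red path [P].  If [R] splits into two halves without red edges in between
    and every class has fewer than half of the vertices of [R], then the blue
    edges between the halves contain a Hamiltonian path (a blow-up of a
    hexagon).  Such a [P] is grown by a depth-first search that always enters
    the red component whose exploration passes the halfway point, until it
    succeeds or some class [Z] reaches exactly half of [R].  In the latter case
    only edges between [Z] and the rest [D] matter: either their red
    components can be balanced, or a component [X] has more than half of [R].
    The search direction provides a red path from the end of [P] to [X]; a
    window of this path whose complement contains equally many vertices of [Z]
    and [D] slides along it until it can enter [X], where alternating between
    [Z] and [D] leads to two equal halves [U], [W] without red edges between
    [Z] and [D].  Then the blue edges contain two balanced bicliques
    ([U] in [Z] with [W] in [D], and vice versa); an analysis of the ends of [P],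
    with rotations of [P] through [U], joins them or absorbs one of them
    into the red path. *)

(** * Chains in complete bipartite graphs *)

(* [lia] case-splits on every boolean hypothesis in sight. *)
Ltac slia := repeat match goal with
  | H : is_true ?b |- _ =>
      lazymatch b with context [leq _ _] => fail | _ => clear H end
  end; lia.

Ltac count_lia :=
  rewrite ?(count_cat, count_rev) /= ?(count_cat, count_rev) /= ?(count_cat, count_rev) /=;
  slia.

Section Chains.
Variables (T : eqType) (r : rel T).
Hypothesis r_sym : symmetric r.

(** A path with both ends recorded, ready for gluing. Repetitions are not excluded:
    duplicate-freeness is recovered at the very end from [perm_eq] with the list of all vertices. *)
Definition chain (w : seq T) (x y : T) : Prop :=
  exists w', [/\ w = x :: w', path r x w' & last x w' = y].

Lemma chain_sorted w x y : chain w x y -> sorted r w.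
Proof. by case=> w' [-> pw _]. Qed.

Lemma sorted_chain x w : sorted r (x :: w) -> chain (x :: w) x (last x w).
Proof. by move=> sw; exists w. Qed.

Lemma chain1 x : chain [:: x] x x.
Proof. by exists [::]. Qed.

Lemma chain_cat w1 w2 x y x' y' :
  chain w1 x y -> chain w2 x' y' -> r y x' -> chain (w1 ++ w2) x y'.
Proof.
case=> v1 [-> p1 <-] [v2 [-> p2 <-]] ryx.
exists (v1 ++ x' :: v2); split=> //; last by rewrite last_cat.
by rewrite cat_path p1 /= ryx.
Qed.

Lemma chain_cons w x y z : r z x -> chain w x y -> chain (z :: w) z y.
Proof. by move=> rzx cw; apply: (chain_cat (chain1 z) cw rzx). Qed.

Lemma chain_rev w x y : chain w x y -> chain (rev w) y x.
Proof.
case=> v [-> p1 <-]; exists (rev (belast x v)); split.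
- by rewrite lastI rev_rcons.
- by rewrite rev_path (eq_path (e' := r)) // => a b; rewrite /= r_sym.
- by case: v p1 => [|a v] //= _; rewrite rev_cons last_rcons.
Qed.

Definition complete (s t : seq T) : Prop := {in s & t, forall x y, r x y}.

Lemma completeC s t : complete s t -> complete t s.
Proof. by move=> c x y xt ys; rewrite r_sym; apply: c. Qed.

Lemma complete_sub s t s' t' :
  {subset s' <= s} -> {subset t' <= t} -> complete s t -> complete s' t'.
Proof. by move=> ss st c x y /ss xs /st; apply: c. Qed.

Lemma complete_catl s1 s2 t : complete s1 t -> complete s2 t -> complete (s1 ++ s2) t.
Proof. by move=> c1 c2 x y; rewrite mem_cat => /orP[] xs; [apply: c1|apply: c2]. Qed.

(** In a balanced biclique the ends may be prescribed on opposite sides: after [x] comes some [y1]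
    other than [y], and the rest is a smaller instance ending in [y]. *)
Lemma balanced_chain s t x y :
  complete s t -> size s = size t -> x \in s -> y \in t ->
  exists2 w, chain w x y & perm_eq w (s ++ t).
Proof.
elim: {s}(size s) {-2}s (erefl (size s)) t x y => [|n IHn] s.
  by move/size0nil=> -> t x y _ _; rewrite in_nil.
move=> Es t x y cst Est xs yt.
have ps := perm_to_rem xs; have pt := perm_to_rem yt.
have Es' : size (rem x s) = n by rewrite size_rem // Es.
have Et' : size (rem y t) = n by rewrite size_rem // -Est Es.
case Ds: (rem x s) => [|x1 s1].
  have Dt: rem y t = [::] by apply: size0nil; rewrite Et' -Es' Ds.
  exists [:: x; y]; first by apply: (chain_cons _ (chain1 y)); apply: cst.
  apply/permP=> a; rewrite count_cat (permP ps) (permP pt) Ds Dt /=; slia.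
case Dt: (rem y t) => [|y1 t1]; first by move: Et' Es'; rewrite Ds Dt /= => <-.
have xs1 : {subset x1 :: s1 <= s} by rewrite -Ds => z /mem_rem.
have yt1 : {subset y1 :: t1 <= t} by rewrite -Dt => z /mem_rem.
have x1in : x1 \in x1 :: s1 by rewrite mem_head.
have y1in : y1 \in y1 :: t1 by rewrite mem_head.
have cst1 : complete (x1 :: s1) (y :: t1).
  apply: complete_sub cst => // z; rewrite inE => /orP[/eqP-> //|zt].
  by apply: yt1; rewrite inE zt orbT.
have Es1 : size (x1 :: s1) = n by rewrite -Ds.
have Est1 : size (x1 :: s1) = size (y :: t1) by rewrite Es1 -Et' Dt.
have [w cw pw] := IHn _ Es1 _ _ _ cst1 Est1 x1in (mem_head y t1).
exists (x :: y1 :: w).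
  apply: (chain_cons (x := y1)); first by apply: cst; rewrite // yt1.
  by apply: (chain_cons _ cw); rewrite r_sym; apply: cst; rewrite ?xs1 ?yt1.
apply/permP=> a; rewrite count_cat (permP ps) (permP pt) Ds Dt /= (permP pw) /=.
rewrite count_cat /=; slia.
Qed.

Lemma pick_mem (s : seq T) : 0 < size s -> exists x, x \in s.
Proof. by case: s => // x s _; exists x; rewrite mem_head. Qed.

Lemma balanced_chain_from s t x :
  complete s t -> size s = size t -> x \in s ++ t ->
  exists w y, chain w x y /\ perm_eq w (s ++ t).
Proof.
move=> cst Est; rewrite mem_cat => /orP[xs|xt].
  have [y yt] : exists y, y \in t by apply: pick_mem; rewrite -Est; case: (s) xs.
  by have [w cw pw] := balanced_chain cst Est xs yt; exists w, y.
have [y ys] : exists y, y \in s by apply: pick_mem; rewrite Est; case: (t) xt.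
have [w cw pw] := balanced_chain (completeC cst) (esym Est) xt ys.
by exists w, y; rewrite (permPl pw) perm_catC.
Qed.

(** The larger side must contain the start; after [x] a balanced biclique remains, entered from
    [t]. *)
Lemma odd_chain_from s t x :
  complete s t -> size s = (size t).+1 -> x \in s ->
  exists w y, chain w x y /\ perm_eq w (s ++ t).
Proof.
move=> cst Est xs; have ps := perm_to_rem xs.
have Es' : size (rem x s) = size t by rewrite size_rem // Est.
case Dt: t Es' => [|y t'] Es'.
  exists [:: x], x; split; first exact: chain1.
  by rewrite cats0 (permPr ps) (size0nil Es').
have cts : complete t (rem x s).
  by apply: complete_sub (completeC cst) => // z /mem_rem.
have yt : y \in t ++ rem x s by rewrite Dt mem_head.
rewrite -Dt in Es' *.
have [w [z [cw pw]]] := balanced_chain_from cts (esym Es') yt.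
exists (x :: w), z; split.
  by apply: (chain_cons _ cw); apply: cst; rewrite ?Dt ?mem_head.
apply/permP=> a; rewrite /= (permP pw) !count_cat (permP ps) /=; slia.
Qed.

Lemma biclique_path s t :
  complete s t -> size s <= (size t).+1 -> size t <= (size s).+1 ->
  exists2 w, sorted r w & perm_eq w (s ++ t).
Proof.
move=> cst le1 le2; have [lt_st|lt_ts|Est] := ltngtP (size s) (size t).
- have Et : size t = (size s).+1 by slia.
  have [y yt] : exists y, y \in t by apply: pick_mem; rewrite Et.
  have [w [z [/chain_sorted cw pw]]] := odd_chain_from (completeC cst) Et yt.
  by exists w => //; rewrite (permPl pw) perm_catC.
- have Es : size s = (size t).+1 by slia.
  have [x xs] : exists x, x \in s by apply: pick_mem; rewrite Es.
  by have [w [z [/chain_sorted cw pw]]] := odd_chain_from cst Es xs; exists w.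
case Ds: s => [|x s']; first by exists [::]; rewrite // (size0nil (s := t)) // -Est Ds.
have xs : x \in s ++ t by rewrite Ds mem_head.
have [w [z [/chain_sorted cw pw]]] := balanced_chain_from cst Est xs.
by exists w => //; rewrite -Ds.
Qed.

Lemma split_size (s : seq T) n :
  n <= size s -> exists s1 s2, perm_eq s (s1 ++ s2) /\ size s1 = n.
Proof.
by move=> le_ns; exists (take n s), (drop n s); rewrite cat_take_drop size_takel.
Qed.

Lemma split_size_mem (s : seq T) n x : x \in s -> 0 < n <= size s ->
  exists s1 s2, [/\ perm_eq s (s1 ++ s2), size s1 = n & x \in s1].
Proof.
move=> xs /andP[n0 le_ns]; have ps := perm_to_rem xs.
exists (x :: take n.-1 (rem x s)), (drop n.-1 (rem x s)); split.
- by rewrite /= cat_take_drop.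
- by rewrite /= size_takel ?prednK // size_rem //; slia.
- exact: mem_head.
Qed.

Lemma perm_catl_sub (s s1 s2 : seq T) : perm_eq s (s1 ++ s2) -> {subset s1 <= s}.
Proof. by move=> ps x xs; rewrite (perm_mem ps) mem_cat xs. Qed.

Lemma perm_catr_sub (s s1 s2 : seq T) : perm_eq s (s1 ++ s2) -> {subset s2 <= s}.
Proof. by move=> ps x xs; rewrite (perm_mem ps) mem_cat xs orbT. Qed.

End Chains.

(** * Blow-ups of a hexagon *)

Section Hexagon.
Variables (T : eqType) (r : rel T).
Hypothesis r_sym : symmetric r.
Local Notation complete := (complete r).

(** The cyclic order of the hexagon is [XA], [YB], [XC], [YA], [XB], [YC]: blocks on different sides
    are joined unless they carry the same letter. Only the letter A has to occur on both sides. *)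
Definition hexagon (XA XB XC YA YB YC : seq T) : Prop :=
  [/\ complete XA (YB ++ YC), complete XB (YA ++ YC), complete XC (YA ++ YB)
    & [/\ 0 < size XA, 0 < size YA &
          size XA + size XB + size XC = size YA + size YB + size YC]].

(** The surplus [j] of [XB] and [XC] over [YA] is taken from [XB] and paired with [j] vertices of
    [YC]. Then [YA] is balanced with what is left of [XB] and [XC], [XA] with what is left of [YB]
    and [YC], and the three bicliques are traversed in a row. *)
Lemma hexagon_one XA XB XC YA YB YC j :
  hexagon XA XB XC YA YB YC -> 0 < j ->
  size XB + size XC = size YA + j -> j <= size XB -> j <= size YC ->
  exists2 w, sorted r w & perm_eq w (XA ++ XB ++ XC ++ YA ++ YB ++ YC).
Proof.
case=> cA cB cC [A0 A'0 E] j0 Ej jB jC.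
have [B1 [B2 [pB sB1]]] := split_size jB; have [C1 [C2 [pC sC1]]] := split_size jC.
have sB := perm_size pB; have sC := perm_size pC; rewrite !size_cat in sB sC.
have [xa xaA] := pick_mem A0; have [ya yaA] := pick_mem A'0.
have [b bB1] : exists b, b \in B1 by apply: pick_mem; rewrite sB1.
have [c cC1] : exists c, c \in C1 by apply: pick_mem; rewrite sC1.
have subB1 := perm_catl_sub pB; have subB2 := perm_catr_sub pB.
have subC1 := perm_catl_sub pC; have subC2 := perm_catr_sub pC.
have cT : complete B1 C1.
  by move=> x y /subB1 xB /subC1 yC; apply: cB; rewrite // mem_cat yC orbT.
have c1 : complete XA (YB ++ C2).
  move=> x y xA; rewrite mem_cat => yD; apply: cA; rewrite // mem_cat.
  by case/orP: yD => [->|/subC2->]; rewrite ?orbT.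
have c2 : complete YA (B2 ++ XC).
  apply: completeC => // x y; rewrite mem_cat => /orP[/subB2 xB|xC] yA.
    by apply: cB; rewrite // mem_cat yA.
  by apply: cC; rewrite // mem_cat yA.
have [w1 [y1 [ch1 pw1]]] := balanced_chain_from r_sym c1 ltac:(rewrite size_cat; slia)
  (x := xa) ltac:(by rewrite mem_cat xaA).
have [w2 [y2 [ch2 pw2]]] := balanced_chain_from r_sym c2 ltac:(rewrite size_cat; slia)
  (x := ya) ltac:(by rewrite mem_cat yaA).
have [w chT pw] := balanced_chain r_sym cT ltac:(slia) bB1 cC1.
have chL := chain_cat (chain_rev r_sym ch2) chT
  ltac:(by rewrite r_sym; apply: cB; rewrite ?subB1 // mem_cat yaA).
have chA := chain_cat chL ch1
  ltac:(by rewrite r_sym; apply: cA; rewrite // mem_cat (subC1 _ cC1) orbT).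
exists ((rev w2 ++ w) ++ w1); first exact: chain_sorted chA.
apply/permP=> p; move: (permP pB p) (permP pC p) (permP pw p) (permP pw1 p) (permP pw2 p).
rewrite !count_cat count_rev; slia.
Qed.

(** Here [XB] is smaller than the surplus [j]: all of it is paired within [YC], and the missing
    [j - size XB] pairs come from [XC] and [YB]. Four balanced bicliques are concatenated. *)
Lemma hexagon_two XA XB XC YA YB YC j :
  hexagon XA XB XC YA YB YC ->
  size XB + size XC = size YA + j -> 0 < size XB < j -> size XB <= size YC ->
  j <= size XB + size YB ->
  exists2 w, sorted r w & perm_eq w (XA ++ XB ++ XC ++ YA ++ YB ++ YC).
Proof.
case=> cA cB cC [A0 A'0 E] Ej /andP[B0 Bj] BC jB.
have [C1 [C2 [pC sC1]]] := split_size BC.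
have [D1 [D2 [pD sD1]]] := split_size (s := XC) (n := j - size XB) ltac:(slia).
have [E1 [E2 [pE sE1]]] := split_size (s := YB) (n := j - size XB) ltac:(slia).
have sC := perm_size pC; have sD := perm_size pD; have sE := perm_size pE.
rewrite !size_cat in sC sD sE.
have [xa xaA] := pick_mem A0; have [ya yaA] := pick_mem A'0.
have [b bB] := pick_mem B0.
have [c cC1] : exists c, c \in C1 by apply: pick_mem; rewrite sC1.
have [d dD1] : exists d, d \in D1 by apply: pick_mem; slia.
have [e eE1] : exists e, e \in E1 by apply: pick_mem; slia.
have [f fD2] : exists f, f \in D2 by apply: pick_mem; slia.
have subC1 := perm_catl_sub pC; have subC2 := perm_catr_sub pC.
have subD1 := perm_catl_sub pD; have subD2 := perm_catr_sub pD.
have subE1 := perm_catl_sub pE; have subE2 := perm_catr_sub pE.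
have c1 : complete D1 E1.
  by move=> x y /subD1 xB /subE1 yC; apply: cC; rewrite // mem_cat yC orbT.
have c2 : complete D2 YA.
  by move=> x y /subD2 xB yC; apply: cC; rewrite // mem_cat yC.
have c3 : complete XB C1.
  by move=> x y xB /subC1 yC; apply: cB; rewrite // mem_cat yC orbT.
have c4 : complete XA (E2 ++ C2).
  move=> x y xA; rewrite mem_cat => yD; apply: cA; rewrite // mem_cat.
  by case/orP: yD => [/subE2->|/subC2->]; rewrite ?orbT.
have [w1 ch1 pw1] := balanced_chain r_sym c1 ltac:(slia) dD1 eE1.
have [w2 ch2 pw2] := balanced_chain r_sym c2 ltac:(slia) fD2 yaA.
have [w3 ch3 pw3] := balanced_chain r_sym c3 ltac:(slia) bB cC1.
have [w4 [z [ch4 pw4]]] := balanced_chain_from r_sym c4 ltac:(rewrite size_cat; slia)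
  (x := xa) ltac:(by rewrite mem_cat xaA).
have ch12 := chain_cat ch1 ch2
  ltac:(by rewrite r_sym; apply: cC; rewrite ?subD2 // mem_cat subE1 ?orbT).
have ch123 := chain_cat ch12 ch3
  ltac:(by rewrite r_sym; apply: cB; rewrite // mem_cat yaA).
have ch1234 := chain_cat ch123 ch4
  ltac:(by rewrite r_sym; apply: cA; rewrite // mem_cat (subC1 _ cC1) orbT).
exists (((w1 ++ w2) ++ w3) ++ w4); first exact: chain_sorted ch1234.
apply/permP=> p; move: (permP pC p) (permP pD p) (permP pE p) (permP pw1 p)
  (permP pw2 p) (permP pw3 p) (permP pw4 p).
rewrite !count_cat; slia.
Qed.

(** The surplus [j] is positive because A has fewer than [m] vertices. Exchanging B with C, or X
    with Y, reduces everything to the two distributions of [j] above; the bounds on B and C provide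
    the room. *)
Lemma hexagon_path XA XB XC YA YB YC :
  hexagon XA XB XC YA YB YC ->
  let m := size XA + size XB + size XC in
  size XA + size YA < m -> size XB + size YB < m -> size XC + size YC < m ->
  exists2 w, sorted r w & perm_eq w (XA ++ XB ++ XC ++ YA ++ YB ++ YC).
Proof.
move=> hex /= mA mB mC; have [cA cB cC [A0 A'0 E]] := hex.
have [j Ej] : exists j, size XB + size XC = size YA + j.
  by exists (size XB + size XC - size YA); slia.
have hexBC : hexagon XA XC XB YA YC YB.
  split=> //; last by split=> //; slia.
  by move=> x y xA; rewrite mem_cat orbC -mem_cat; apply: cA.
have hexXY : hexagon YA YC YB XA XC XB.
  split; [| | |by split=> //; slia].
  - apply: completeC => //; apply: complete_catl => x y xX yA.
      by apply: cC; rewrite // mem_cat yA.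
    by apply: cB; rewrite // mem_cat yA.
  - apply: completeC => //; apply: complete_catl => x y xX yA.
      by apply: cA; rewrite // mem_cat yA orbT.
    by apply: cB; rewrite // mem_cat yA orbT.
  - apply: completeC => //; apply: complete_catl => x y xX yA.
      by apply: cA; rewrite // mem_cat yA.
    by apply: cC; rewrite // mem_cat yA orbT.
have [/andP[jB jC]|n1] := boolP ((j <= size XB) && (j <= size YC)).
  by apply: (hexagon_one hex _ Ej) => //; slia.
have [/andP[jB jC]|n2] := boolP ((j <= size XC) && (j <= size YB)).
  have [||w sw pw] := hexagon_one (j := j) hexBC _ _ jB jC; [slia|slia|].
  by exists w => //; apply/permP=> p; rewrite (permP pw) !count_cat; slia.
have [le|lt] := leqP (size XB) (size YC).
  by apply: (hexagon_two hex Ej); slia.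
have [||||w sw pw] := hexagon_two (j := j) hexXY; [slia|slia|slia|slia|].
by exists w => //; apply/permP=> p; rewrite (permP pw) !count_cat; slia.
Qed.

(** Splitting both sides by label gives a blow-up of a hexagon; a label that occurs on both sides is
    chosen as A. *)
Lemma three_label_path (lab : T -> nat) (xs ys : seq T) :
  size xs = size ys -> (forall x, x \in xs ++ ys -> lab x < 3) ->
  (forall i, count (fun x => lab x == i) (xs ++ ys) < size xs) ->
  {in xs & ys, forall x y, lab x != lab y -> r x y} ->
  exists2 w, sorted r w & perm_eq w (xs ++ ys).
Proof.
move=> Es lab3 cnt rxy.
pose F i (s : seq T) := [seq x <- s | lab x == i].
have sizeF i s : size (F i s) = count (fun x => lab x == i) s by rewrite size_filter.
have cF i j k s t : j != i -> k != i -> {subset s <= xs} -> {subset t <= ys} ->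
    complete (F i s) (F j t ++ F k t).
  move=> ji ki ss st x y; rewrite mem_cat !mem_filter.
  case/andP=> /eqP li /ss xs' /orP[]/andP[/eqP lj /st yt]; apply: rxy => //;
  by rewrite li lj eq_sym.
have main i j k : uniq [:: i; j; k] -> (forall x, x \in xs ++ ys -> lab x \in [:: i; j; k]) ->
    0 < size (F i xs) -> 0 < size (F i ys) ->
    exists2 w, sorted r w & perm_eq w (xs ++ ys).
  rewrite /= !inE negb_or -!andbA => /and4P[ij ik jk _] labin i1 i2.
  have neqs := (negPf ij, negPf ik, negPf jk, eq_sym j i, eq_sym k i, eq_sym k j).
  have cF3 s : {subset s <= xs ++ ys} -> forall a,
      count a s = count a (F i s) + count a (F j s) + count a (F k s).
    elim: s => [|x s IHs] ss a //=; rewrite IHs; last first.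
      by move=> z zs; apply: ss; rewrite inE zs orbT.
    have := labin x (ss x (mem_head _ _)); rewrite !inE.
    by case/or3P=> /eqP->; rewrite eqxx !neqs /=; slia.
  have subx : {subset xs <= xs ++ ys} by move=> x xx; rewrite mem_cat xx.
  have suby : {subset ys <= xs ++ ys} by move=> x xx; rewrite mem_cat xx orbT.
  have Sx := cF3 _ subx predT; have Sy := cF3 _ suby predT.
  rewrite !count_predT in Sx Sy.
  have hex : hexagon (F i xs) (F j xs) (F k xs) (F i ys) (F j ys) (F k ys).
    split; [| | |by split=> //; slia]; apply: cF => //; by rewrite eq_sym.
  have := (cnt i, cnt j, cnt k); rewrite !count_cat -!sizeF => -[[ci cj] ck].
  have [|||w sw pw] := hexagon_path hex; [slia|slia|slia|].
  exists w => //; apply/permP=> a; rewrite (permP pw) !count_cat (cF3 _ subx) (cF3 _ suby); slia.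
have l012 x : x \in xs ++ ys -> lab x \in [:: 0; 1; 2].
  by move/lab3; rewrite !inE; case: (lab x) => [|[|[|]]].
have [/andP[x0 y0]|n0] := boolP ((0 < size (F 0 xs)) && (0 < size (F 0 ys))).
  by apply: (main 0 1 2).
have [/andP[x1 y1]|n1] := boolP ((0 < size (F 1 xs)) && (0 < size (F 1 ys))).
  by apply: (main 1 0 2) => // x /l012; rewrite !inE orbCA.
have [/andP[x2 y2]|n2] := boolP ((0 < size (F 2 xs)) && (0 < size (F 2 ys))).
  by apply: (main 2 1 0) => // x /l012; rewrite !inE; case: (lab x) => [|[|[|]]].
(* No label occurs on both sides, so one side carries at most one label, which then has at least
   [size xs] vertices, against [cnt]. *)
have cF3 s : {subset s <= xs ++ ys} -> size s = size (F 0 s) + size (F 1 s) + size (F 2 s).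
  elim: s => [|x s IHs] ss //=; rewrite IHs; last first.
    by move=> z zs; apply: ss; rewrite inE zs orbT.
  have := l012 x (ss x (mem_head _ _)); rewrite !inE.
  by case/or3P=> /eqP->; rewrite /=; slia.
have Sx := cF3 xs ltac:(by move=> x xx; rewrite mem_cat xx).
have Sy := cF3 ys ltac:(by move=> x xx; rewrite mem_cat xx orbT).
have := (cnt 0, cnt 1, cnt 2); rewrite !count_cat -!sizeF => -[[c0 c1] c2]; slia.
Qed.

End Hexagon.

(** * Depth-first exploration *)

Section Exploration.
Variables (T : finType) (e : rel T).
Hypothesis e_sym : symmetric e.
Implicit Types R S U W X Q : {set T}.

(** [S] is a union of connected components of the graph induced on [R], expressed without paths. *)
Definition closed_in R S : bool :=
  (S \subset R) && [forall x in S, forall y in R :\: S, ~~ e x y].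

Lemma closed_inP R S :
  reflect (S \subset R /\ (forall x y, x \in S -> y \in R -> y \notin S -> ~~ e x y))
          (closed_in R S).
Proof.
apply: (iffP andP) => -[sSR clS]; split=> //.
  move=> x y xS yR yS; apply: (forall_inP (forall_inP clS x xS)).
  by rewrite inE yS.
apply/forall_inP=> x xS; apply/forall_inP=> y; rewrite inE => /andP[yS yR].
exact: clS.
Qed.

Lemma closed_in0 R : closed_in R set0.
Proof. by apply/closed_inP; split; rewrite ?sub0set // => x y; rewrite inE. Qed.

Lemma closed_inT R : closed_in R R.
Proof. by apply/closed_inP; split=> // x y _ ->. Qed.

Lemma closed_inU R S U : closed_in R S -> closed_in R U -> closed_in R (S :|: U).
Proof.
case/closed_inP=> sS cS /closed_inP[sU cU]; apply/closed_inP.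
split; first by rewrite subUset sS.
move=> x y; rewrite !inE negb_or => /orP[xS|xU] yR /andP[yS yU]; first exact: cS.
exact: cU.
Qed.

Lemma closed_inD R S U : closed_in R S -> closed_in R U -> closed_in R (S :\: U).
Proof.
case/closed_inP=> sS cS /closed_inP[sU cU]; apply/closed_inP.
split; first by rewrite (subset_trans (subsetDl _ _)).
move=> x y; rewrite !inE => /andP[xU xS] yR; rewrite negb_and negbK => /orP[yU|yS].
  by rewrite e_sym; apply: cU => //; apply: (subsetP sS).
exact: cS.
Qed.

Lemma closed_in_trans R S U : closed_in R S -> closed_in S U -> closed_in R U.
Proof.
case/closed_inP=> sS cS /closed_inP[sU cU]; apply/closed_inP.
split; first exact: subset_trans sU sS.
move=> x y xU yR yU; have [yS|yS] := boolP (y \in S); first exact: cU.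
by apply: cS => //; apply: (subsetP sU).
Qed.

Lemma closed_in_sub R R' S :
  closed_in R S -> R' \subset R -> S \subset R' -> closed_in R' S.
Proof.
case/closed_inP=> sS cS sR' sS'; apply/closed_inP; split=> // x y xS yR' yS.
by apply: cS => //; apply: (subsetP sR').
Qed.

Lemma closed_in_setI R S X : closed_in R S -> X \subset R -> closed_in X (S :&: X).
Proof.
case/closed_inP=> sS cS sXR; apply/closed_inP; split; first exact: subsetIr.
move=> x y; rewrite !inE => /andP[xS _] yX; rewrite yX andbT => yS.
by apply: cS => //; apply: (subsetP sXR).
Qed.

(** Stated through closed sets, so that a minimal non-empty closed set is connected by
    definition. *)
Definition connected_set X : Prop :=
  X != set0 /\ (forall S, S != set0 -> closed_in X S -> S = X).

Definition halved R : Prop := exists2 U, closed_in R U & 2 * #|U| = #|R|.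

(* [X] is a component of [R] whose exploration makes the explored part [W]
   overtake the unexplored one. *)
Record state R W X : Prop := State {
  state_W : closed_in R W;
  state_X : closed_in R X;
  state_conn : connected_set X;
  state_disj : [disjoint W & X];
  state_lt : 2 * #|W| < #|R|;
  state_gt : #|R| < 2 * (#|W| + #|X|) }.

(** Take a largest union [S] of components inside [Q] such that [W :|: S] has at most half of [R].
    Either it reaches half, or any component left in [Q] overshoots. *)
Lemma halved_or_state R W Q :
  closed_in R W -> closed_in R Q -> [disjoint W & Q] ->
  2 * #|W| <= #|R| -> #|R| <= 2 * (#|W| + #|Q|) ->
  halved R \/ exists W' X, state R W' X /\ X \subset Q.
Proof.
move=> cW cQ dWQ leW geQ.
pose ok S := [&& S \subset Q, closed_in R S & 2 * (#|W| + #|S|) <= #|R|].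
have ok0 : ok set0 by rewrite /ok sub0set closed_in0 cards0 addn0.
case: (arg_maxnP (fun S : {set T} => #|S|) ok0) => S /and3P[sSQ cS leS] maxS.
have cWS := closed_inU cW cS.
have dWS : [disjoint W & S] by apply: disjointWr dWQ.
have cardWS : #|W :|: S| = #|W| + #|S| by apply/eqP; rewrite (leq_card_setU W S).2.
have [eqS|neS] := eqVneq (2 * (#|W| + #|S|)) #|R|.
  by left; exists (W :|: S); rewrite ?cardWS.
move/eqP: neS => neS; right; have [D0|D0] := eqVneq (Q :\: S) set0.
  have QS : Q = S by apply/eqP; rewrite eqEsubset sSQ -setD_eq0 D0 eqxx.
  by rewrite -QS in leS neS; slia.
pose okX X := [&& X != set0, X \subset Q :\: S & closed_in R X].
have okD : okX (Q :\: S) by rewrite /okX D0 subxx closed_inD.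
case: (arg_minnP (fun X : {set T} => #|X|) okD) => X /and3P[X0 sX cX] minX.
exists (W :|: S), X; split; last by apply: subset_trans sX (subsetDl _ _).
have dSX : [disjoint S & X].
  by rewrite disjoint_sym; apply/pred0P=> x /=; apply/andP=> -[/(subsetP sX)];
     rewrite inE => /andP[/negP].
have dWX : [disjoint W & X].
  by apply: disjointWr dWQ; apply: subset_trans sX (subsetDl _ _).
split=> //.
- split=> // V V0 cV; apply/eqP; have [sV _] := closed_inP _ _ cV.
  rewrite eqEcard sV minX // /okX V0 (subset_trans sV sX).
  exact: closed_in_trans cX cV.
- by rewrite -setI_eq0 setIUl setU_eq0 !setI_eq0 dWX dSX.
- by rewrite cardWS; slia.
- have cardSX : #|S :|: X| = #|S| + #|X| by apply/eqP; rewrite (leq_card_setU S X).2.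
  rewrite cardWS ltnNge; apply/negP=> leX.
  have /maxS : ok (S :|: X).
    rewrite /ok subUset sSQ closed_inU // (subset_trans sX (subsetDl _ _)) /= cardSX.
    by slia.
  by move: X0; rewrite cardSX -card_gt0; slia.
Qed.

(** One step of the search: [y] goes to the path and [X :\ y] may fall apart. The strict
    inequalities of a state leave just enough slack for the loss of one vertex. *)
Lemma state_step R W X y :
  state R W X -> y \in X ->
  halved (R :\ y) \/
  exists W' X', [/\ state (R :\ y) W' X', X' \subset X & exists2 z, z \in X' & e y z].
Proof.
case=> cW cX connX dWX ltW gtX yX.
have sXR : X \subset R by case/closed_inP: cX.
have sWR : W \subset R by case/closed_inP: cW.
have yW : y \notin W by move: dWX; rewrite disjoint_sym => /disjointFr->.
have yR := subsetP sXR y yX.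
have cardR : #|R| = #|R :\ y|.+1 by rewrite (cardsD1 y R) yR.
have cardX : #|X| = #|X :\ y|.+1 by rewrite (cardsD1 y X) yX.
have cW' : closed_in (R :\ y) W.
  by apply: closed_in_sub cW _ _; rewrite ?subsetDl // subsetD1 sWR.
have cX' : closed_in (R :\ y) (X :\ y).
  apply/closed_inP; split; first exact: setSD.
  move=> a b; rewrite !inE => /andP[_ aX] /andP[-> bR] bX.
  by have [_ cl] := closed_inP _ _ cX; apply: cl.
have dWX' : [disjoint W & X :\ y] by apply: disjointWr dWX; apply: subsetDl.
case: (halved_or_state cW' cX' dWX'); [slia|slia|by left|].
move=> [W' [X' [st sX']]]; right; exists W', X'; split=> //.
  by apply: subset_trans sX' (subsetDl _ _).
have [X'0 _] := state_conn st; have [_ connXP] := connX.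
have [/exists_inP //|/exists_inPn noz] := boolP [exists z in X', e y z].
(* Without a neighbour of [y], the set [X'] would be closed in the connected set [X], hence equal to
   it, although it misses [y]. *)
have : closed_in X X'.
  apply/closed_inP; split; first by apply: subset_trans sX' (subsetDl _ _).
  move=> a b aX' bX bX'; have [->|nby] := eqVneq b y; first by rewrite e_sym noz.
  have [_ cl] := closed_inP _ _ (state_X st); apply: cl => //.
  by rewrite !inE nby (subsetP sXR).
move/(connXP _ X'0)=> EX; move: yX; rewrite -EX => /(subsetP sX').
by rewrite !inE eqxx.
Qed.

Lemma halved_or_initial R :
  halved R \/ exists W X, state R W X.
Proof.
case: (@halved_or_state R set0 R); rewrite ?closed_in0 ?closed_inT ?cards0 //.
- by rewrite -setI_eq0 set0I.
- by rewrite add0n; slia.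
- by left.
- by move=> [W [X [st _]]]; right; exists W, X.
Qed.

End Exploration.

(** * Absorbing two bicliques into a red path *)

Section TwoPaths.
Variables (T : eqType) (V : seq T) (rd bl : rel T).
Hypotheses (rd_sym : symmetric rd) (bl_sym : symmetric bl).

Definition two_paths : Prop :=
  exists r b : seq T, [/\ perm_eq (r ++ b) V, sorted rd r & sorted bl b].

(** The differences [a1 - b1] and [a2 - b2] have the same sign and differ by at most one, so that
    the two surpluses form a nearly balanced biclique. *)
Definition close_sizes (a1 b1 a2 b2 : nat) : bool :=
  [&& (b1 <= a1) && (b2 <= a2) || (a1 <= b1) && (a2 <= b2),
      a1 + b2 <= (a2 + b1).+1 & a2 + b1 <= (a1 + b2).+1].

(** [a1] and [a2] are cut down to the sizes of [b1] and [b2] while keeping [xa] and [ya]; the parts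
    cut off are covered by the blue path [bb]. *)
Lemma absorb_le (a1 b1 a2 b2 : seq T) xa ya :
  complete bl a1 a2 -> xa \in a1 -> ya \in a2 ->
  0 < size b1 <= size a1 -> 0 < size b2 <= size a2 ->
  size a1 + size b2 <= (size a2 + size b1).+1 ->
  size a2 + size b1 <= (size a1 + size b2).+1 ->
  exists a1' a2' bb,
    [/\ size a1' = size b1, size a2' = size b2, xa \in a1', ya \in a2' & sorted bl bb]
    /\ [/\ {subset a1' <= a1}, {subset a2' <= a2}
         & perm_eq (a1 ++ a2) (a1' ++ a2' ++ bb)].
Proof.
move=> cA xa1 ya2 sb1 sb2 le1 le2.
have [a1' [a1'' [p1 s1 xa1']]] := split_size_mem xa1 sb1.
have [a2' [a2'' [p2 s2 ya2']]] := split_size_mem ya2 sb2.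
have := (perm_size p1, perm_size p2); rewrite !size_cat => -[e1 e2].
have cA'' : complete bl a1'' a2''.
  by apply: complete_sub cA; [apply: perm_catr_sub p1|apply: perm_catr_sub p2].
have [bb sbb pbb] := biclique_path bl_sym cA'' ltac:(slia) ltac:(slia).
exists a1', a2', bb; split=> //; split; [exact: perm_catl_sub p1|exact: perm_catl_sub p2|].
apply/permP=> p; move: (permP p1 p) (permP p2 p) (permP pbb p); rewrite !count_cat; slia.
Qed.

Lemma absorb (a1 b1 a2 b2 : seq T) xa xb ya yb :
  complete bl a1 a2 -> complete bl b1 b2 ->
  xa \in a1 -> xb \in b1 -> ya \in a2 -> yb \in b2 ->
  close_sizes (size a1) (size b1) (size a2) (size b2) ->
  exists a1' b1' a2' b2' bb,
    [/\ size a1' = size b1', size a2' = size b2', sorted bl bb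
      & perm_eq (a1 ++ b1 ++ a2 ++ b2) (a1' ++ b1' ++ a2' ++ b2' ++ bb)]
    /\ [/\ xa \in a1', xb \in b1', ya \in a2' & yb \in b2']
    /\ [/\ {subset a1' <= a1}, {subset b1' <= b1},
           {subset a2' <= a2} & {subset b2' <= b2}].
Proof.
move=> cA cB xa1 xb1 ya2 yb2 /and3P[le le1 le2].
have pos (s : seq T) x : x \in s -> 0 < size s by case: s.
have [q1 q2 q3 q4] := And4 (pos _ _ xa1) (pos _ _ xb1) (pos _ _ ya2) (pos _ _ yb2).
case/orP: le => /andP[l1 l2].
  have [a1' [a2' [bb [[s1 s2 x1 y1 sb] [i1 i2 pp]]]]] :=
    absorb_le (b1 := b1) (b2 := b2) cA xa1 ya2 ltac:(by rewrite q2) ltac:(by rewrite q4)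
      le1 le2.
  exists a1', b1, a2', b2, bb; split; [split=> //|by split; split].
  by apply/permP=> p; have := permP pp p; rewrite !count_cat; slia.
have [b1' [b2' [bb [[s1 s2 x1 y1 sb] [i1 i2 pp]]]]] :=
  absorb_le (b1 := a1) (b2 := a2) cB xb1 yb2 ltac:(by rewrite q1) ltac:(by rewrite q3)
    ltac:(slia) ltac:(slia).
exists a1, b1', a2, b2', bb; split; [split=> //|by split; split].
by apply/permP=> p; have := permP pp p; rewrite !count_cat; slia.
Qed.

(** * Four blocks in a cycle of alternately red and blue bicliques *)

Section Quadrilateral.
Variables (P a1 b1 a2 b2 : seq T).
Hypothesis coverV : perm_eq (P ++ a1 ++ b1 ++ a2 ++ b2) V.
Hypotheses (blA : complete bl a1 a2) (blB : complete bl b1 b2).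
Hypotheses (rd1 : complete rd a1 b1) (rd2 : complete rd a2 b2).
Hypothesis sizes : close_sizes (size a1) (size b1) (size a2) (size b2).
Hypotheses (a1_gt0 : 0 < size a1) (b1_gt0 : 0 < size b1).
Hypotheses (a2_gt0 : 0 < size a2) (b2_gt0 : 0 < size b2).

(** After trimming, both red bicliques are balanced and one is attached at each end of [P]; the
    trimmed vertices form the blue path. *)
Lemma absorb_both_ends p q u w :
  chain rd P p q -> u \in a1 ++ b1 -> rd q u -> w \in a2 ++ b2 -> rd p w -> two_paths.
Proof.
move=> chP uin ru win rw.
have [xa xa1] := pick_mem a1_gt0; have [xb xb1] := pick_mem b1_gt0.
have [ya ya2] := pick_mem a2_gt0; have [yb yb2] := pick_mem b2_gt0.
have [a1' [b1' [a2' [b2' [bb [[s1 s2 sb pp] [[u1 w1] [i1 i2 i3 i4]]]]]]]] :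
    exists a1' b1' a2' b2' bb,
    [/\ size a1' = size b1', size a2' = size b2', sorted bl bb
      & perm_eq (a1 ++ b1 ++ a2 ++ b2) (a1' ++ b1' ++ a2' ++ b2' ++ bb)]
    /\ (u \in a1' ++ b1' /\ w \in a2' ++ b2')
    /\ [/\ {subset a1' <= a1}, {subset b1' <= b1},
           {subset a2' <= a2} & {subset b2' <= b2}].
  move: uin win; rewrite !mem_cat => /orP[]uin /orP[]win.
  - have [a1' [b1' [a2' [b2' [bb [? [[e1 e2 e3 e4] ?]]]]]]] := absorb blA blB uin xb1 win yb2 sizes.
    by exists a1', b1', a2', b2', bb; rewrite !mem_cat e1 e3.
  - have [a1' [b1' [a2' [b2' [bb [? [[e1 e2 e3 e4] ?]]]]]]] := absorb blA blB uin xb1 ya2 win sizes.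
    by exists a1', b1', a2', b2', bb; rewrite !mem_cat e1 e4 orbT.
  - have [a1' [b1' [a2' [b2' [bb [? [[e1 e2 e3 e4] ?]]]]]]] := absorb blA blB xa1 uin win yb2 sizes.
    by exists a1', b1', a2', b2', bb; rewrite !mem_cat e2 e3 orbT.
  - have [a1' [b1' [a2' [b2' [bb [? [[e1 e2 e3 e4] ?]]]]]]] := absorb blA blB xa1 uin ya2 win sizes.
    by exists a1', b1', a2', b2', bb; rewrite !mem_cat e2 e4 !orbT.
have [v1 [y1 [ch1 pv1]]] := balanced_chain_from rd_sym (complete_sub i1 i2 rd1) s1 u1.
have [v2 [y2 [ch2 pv2]]] := balanced_chain_from rd_sym (complete_sub i3 i4 rd2) s2 w1.
have ch := chain_cat (chain_cat (chain_rev rd_sym ch2) chP ltac:(by rewrite rd_sym)) ch1 ru.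
exists ((rev v2 ++ P) ++ v1), bb; split=> //; last exact: chain_sorted ch.
rewrite -(permPr coverV); apply/permP=> x.
move: (permP pp x) (permP pv1 x) (permP pv2 x); rewrite !count_cat count_rev; slia.
Qed.

(** Both trimmed red bicliques are put behind [P], the first traversed from [u0] to [u], the second
    entered at [w]. *)
Lemma absorb_through_link u0 u w :
  P = [::] \/ (exists p q, chain rd P p q /\ rd q u0) ->
  u0 \in a1 -> u \in b1 -> w \in a2 -> rd u w -> two_paths.
Proof.
move=> hP u0a ub wa ruw; have [yb yb2] := pick_mem b2_gt0.
have [a1' [b1' [a2' [b2' [bb [[s1 s2 sb pp] [[e1 e2 e3 e4] [i1 i2 i3 i4]]]]]]]] :=
  absorb blA blB u0a ub wa yb2 sizes.
have [v1 ch1 pv1] := balanced_chain rd_sym (complete_sub i1 i2 rd1) s1 e1 e2.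
have [v2 ch2 pv2] := balanced_chain rd_sym (complete_sub i3 i4 rd2) s2 e3 e4.
have ch := chain_cat ch1 ch2 ruw.
exists (P ++ v1 ++ v2), bb; split=> //.
  rewrite -(permPr coverV); apply/permP=> x.
  move: (permP pp x) (permP pv1 x) (permP pv2 x); rewrite !count_cat; slia.
case: hP => [->|[p [q [chP rq]]]]; first exact: chain_sorted ch.
exact: chain_sorted (chain_cat chP ch rq).
Qed.

End Quadrilateral.
End TwoPaths.

(** * Joining the two blue bicliques *)

Section Configurations.
Variables (T : eqType) (V : seq T) (cl : T -> nat) (rd bl : rel T) (z0 : nat).
Hypotheses (rd_sym : symmetric rd) (bl_sym : symmetric bl).
Hypothesis rd_cl : forall x y, rd x y -> cl x != cl y.
Hypothesis rd_or_bl : forall x y, cl x != cl y -> ~~ rd x y -> bl x y.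
Local Notation two_paths := (two_paths V rd bl).

Definition inZ (x : T) : bool := cl x == z0.

Lemma inZ_cl x y : inZ x != inZ y -> cl x != cl y.
Proof. by apply: contraNneq; rewrite /inZ => ->. Qed.

(* The vertices outside the red path [P] are split into the halves
   [uz ++ ud] and [wz ++ wd], where [uz] and [wz] lie in the class [z0], and
   all edges between the two halves that meet that class are blue. *)
Record config (P uz ud wz wd : seq T) : Prop := Config {
  cf_cover : perm_eq (P ++ uz ++ ud ++ wz ++ wd) V;
  cf_path : sorted rd P;
  cf_uz : {in uz, forall x, inZ x};
  cf_ud : {in ud, forall x, ~~ inZ x};
  cf_wz : {in wz, forall x, inZ x};
  cf_wd : {in wd, forall x, ~~ inZ x};
  cf_sz : size uz = size wd;
  cf_sd : size ud = size wz;
  cf_blz : complete bl uz wd;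
  cf_bld : complete bl ud wz }.

Lemma config_swap P uz ud wz wd : config P uz ud wz wd -> config P wz wd uz ud.
Proof.
case=> cov sP Huz Hud Hwz Hwd sz sd bz bd; split=> //; try exact: completeC.
by rewrite -(permPr cov); apply/permP=> a; count_lia.
Qed.

Lemma config_rev P uz ud wz wd : config P uz ud wz wd -> config (rev P) uz ud wz wd.
Proof.
case=> cov sP Huz Hud Hwz Hwd sz sd bz bd; split=> //.
  by rewrite -(permPr cov); apply/permP=> a; count_lia.
case: P sP {cov} => // x P /sorted_chain ch.
exact: chain_sorted (chain_rev rd_sym ch).
Qed.

Lemma config_trivial P uz ud wz wd :
  config P uz ud wz wd -> (size uz == 0) || (size ud == 0) -> two_paths.
Proof.
case=> cov sP Huz Hud Hwz Hwd sz sd bz bd /orP[]/eqP s0.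
  have [b sb pb] := biclique_path bl_sym bd ltac:(slia) ltac:(slia).
  exists P, b; split=> //; rewrite -(permPr cov) (size0nil s0).
  have -> : wd = [::] by apply: size0nil; rewrite -sz.
  by apply/permP=> a; move: (permP pb a); count_lia.
have [b sb pb] := biclique_path bl_sym bz ltac:(slia) ltac:(slia).
exists P, b; split=> //; rewrite -(permPr cov) (size0nil s0).
have -> : wz = [::] by apply: size0nil; rewrite -sd.
by apply/permP=> a; move: (permP pb a); count_lia.
Qed.

(** The case left when both blue bicliques are non-empty and no blue edge joins them: edges of the
    graph between them are then red. *)
Record rigid (P uz ud wz wd : seq T) : Prop := Rigid {
  rg_cf :> config P uz ud wz wd;
  rg_uz : 0 < size uz;
  rg_ud : 0 < size ud;
  rg_bl : {in uz ++ wd & ud ++ wz, forall x y, ~~ bl x y} }.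

Lemma config_chains P uz ud wz wd x y :
  config P uz ud wz wd -> x \in uz ++ wd -> y \in ud ++ wz ->
  exists v1 v2 x' y', [/\ chain bl v1 x' x, chain bl v2 y y',
    perm_eq v1 (uz ++ wd) & perm_eq v2 (ud ++ wz)].
Proof.
case=> cov sP Huz Hud Hwz Hwd sz sd bz bd xin yin.
have [v1 [x' [ch1 pv1]]] := balanced_chain_from bl_sym bz sz xin.
have [v2 [y' [ch2 pv2]]] := balanced_chain_from bl_sym bd sd yin.
exists (rev v1), v2, x', y'; split=> //; first exact: chain_rev.
by rewrite perm_rev.
Qed.

Lemma config_rigid P uz ud wz wd :
  config P uz ud wz wd -> two_paths \/ rigid P uz ud wz wd.
Proof.
move=> cf; have [s0|] := boolP ((size uz == 0) || (size ud == 0)).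
  by left; apply: config_trivial cf s0.
rewrite negb_or -!lt0n => /andP[uz0 ud0].
have [/hasP[x xin /hasP[y yin bxy]]|nbl] :=
  boolP (has (fun x => has (bl x) (ud ++ wz)) (uz ++ wd)); last first.
  right; split=> // x y xin yin; apply: contra nbl => bxy.
  by apply/hasP; exists x => //; apply/hasP; exists y.
left; have [v1 [v2 [x' [y' [ch1 ch2 p1 p2]]]]] := config_chains cf xin yin.
exists P, (v1 ++ v2); split; [|exact: cf_path cf|exact: chain_sorted (chain_cat ch1 ch2 bxy)].
rewrite -(permPr (cf_cover cf)); apply/permP=> a; move: (permP p1 a) (permP p2 a).
count_lia.
Qed.

Lemma rigid_swap P uz ud wz wd : rigid P uz ud wz wd -> rigid P wz wd uz ud.
Proof.
case=> cf uz0 ud0 nb; split; first exact: config_swap.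
- by rewrite -(cf_sd cf).
- by rewrite -(cf_sz cf).
- move=> x y xin yin; rewrite bl_sym; apply: nb; rewrite mem_cat orbC -mem_cat //.
Qed.

Lemma rigid_rev P uz ud wz wd : rigid P uz ud wz wd -> rigid (rev P) uz ud wz wd.
Proof. by case=> cf uz0 ud0 nb; split=> //; apply: config_rev. Qed.

(** [p] leaves the red path and links the two blue bicliques. *)
Lemma end_blue P p uz ud wz wd x y :
  config (p :: P) uz ud wz wd ->
  x \in uz ++ wd -> y \in ud ++ wz -> bl p x -> bl p y -> two_paths.
Proof.
move=> cf xin yin bx bY.
have [v1 [v2 [x' [y' [ch1 ch2 p1 p2]]]]] := config_chains cf xin yin.
exists P, (v1 ++ p :: v2); split; last 2 first.
- by have := cf_path cf; apply: path_sorted.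
- apply: (chain_sorted (chain_cat ch1 (chain_cons bY ch2) _)).
  by rewrite bl_sym.
rewrite -(permPr (cf_cover cf)); apply/permP=> a; move: (permP p1 a) (permP p2 a).
count_lia.
Qed.

(** * Red edges forced by the absence of blue edges between the bicliques *)

Section Rigid.
Variables (P uz ud wz wd : seq T).
Hypothesis rg : rigid P uz ud wz wd.

Lemma rigid_sizes : [/\ 0 < size uz, 0 < size ud, 0 < size wz & 0 < size wd].
Proof. by case: rg => cf ? ?; rewrite -(cf_sz cf) -(cf_sd cf). Qed.

Lemma rigid_rdU : complete rd uz ud.
Proof.
move=> x y xu yu; have cf := rg_cf rg.
have := rg_bl rg (x := x) (y := y); rewrite !mem_cat xu yu => /(_ isT isT).
apply: contraR; apply: rd_or_bl; apply: inZ_cl.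
by rewrite (cf_uz cf xu) (negPf (cf_ud cf yu)).
Qed.

Lemma rigid_rdW : complete rd wd wz.
Proof.
move=> x y xu yu; have cf := rg_cf rg.
have := rg_bl rg (x := x) (y := y); rewrite !mem_cat xu yu !orbT => /(_ isT isT).
apply: contraR; apply: rd_or_bl; apply: inZ_cl.
by rewrite (cf_wz cf yu) (negPf (cf_wd cf xu)).
Qed.

Lemma rigid_link u w : u \in ud -> w \in wd -> cl u != cl w -> rd u w.
Proof.
move=> uu ww; rewrite rd_sym eq_sym => ne.
have := rg_bl rg (x := w) (y := u); rewrite !mem_cat uu ww orbT => /(_ isT isT).
by apply: contraR; apply: rd_or_bl.
Qed.

Lemma rigid_both_ends p q u w : chain rd P p q ->
  u \in uz ++ ud -> rd q u -> w \in wz ++ wd -> rd p w -> two_paths.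
Proof.
move=> chP uin ru win rw; have cf := rg_cf rg; have [s1 s2 s3 s4] := rigid_sizes.
have win' : w \in wd ++ wz by rewrite mem_cat orbC -mem_cat.
refine (absorb_both_ends rd_sym bl_sym _ (cf_blz cf) (cf_bld cf) rigid_rdU rigid_rdW
  _ s1 s2 s4 s3 chP uin ru win' rw).
  by rewrite -(permPr (cf_cover cf)); apply/permP=> a; count_lia.
by rewrite /close_sizes (cf_sz cf) (cf_sd cf); slia.
Qed.

Lemma opposite_in_half t : exists2 u, u \in uz ++ ud & inZ u != inZ t.
Proof.
have cf := rg_cf rg; have [s1 s2 _ _] := rigid_sizes.
have [x xu] := pick_mem s1; have [y yu] := pick_mem s2.
have [zt|zt] := boolP (inZ t).
  by exists y; rewrite ?mem_cat ?yu ?orbT // (negPf (cf_ud cf yu)).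
by exists x; rewrite ?mem_cat ?xu // (cf_uz cf xu).
Qed.

Definition red_to (s : seq T) (t : T) : Prop :=
  {in s, forall x, inZ x != inZ t -> rd t x}.

Definition not_red_to (s : seq T) (t : T) : Prop :=
  {in s, forall x, inZ x != inZ t -> ~~ rd t x}.

(** With blue edges into both bicliques, [p] links them. Otherwise it has none into one biclique,
    and the vertices of that biclique across the class [z0] from [p] are exactly those of one
    half. *)
Lemma end_red_to P' p : P = p :: P' ->
  two_paths \/ red_to (uz ++ ud) p \/ red_to (wz ++ wd) p.
Proof.
move=> EP; have cf := rg_cf rg.
have [/hasP[x xin bx]|n1] := boolP (has (bl p) (uz ++ wd)); last first.
  have rx x : x \in uz ++ wd -> inZ x != inZ p -> rd p x.
    move=> xin tx; apply: contraR n1 => nrd; apply/hasP; exists x => //.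
    by apply: rd_or_bl => //; apply: inZ_cl; rewrite eq_sym.
  right; have [zp|zp] := boolP (inZ p); [right|left].
    move=> x; rewrite mem_cat => /orP[xw|xw] tx.
      by rewrite (cf_wz cf xw) zp in tx.
    by apply: rx; rewrite // mem_cat xw orbT.
  move=> x; rewrite mem_cat => /orP[xw|xw] tx.
    by apply: rx; rewrite // mem_cat xw.
  by rewrite (negPf (cf_ud cf xw)) (negPf zp) in tx.
have [/hasP[y yin bY]|n2] := boolP (has (bl p) (ud ++ wz)); last first.
  have rx y : y \in ud ++ wz -> inZ y != inZ p -> rd p y.
    move=> yin ty; apply: contraR n2 => nrd; apply/hasP; exists y => //.
    by apply: rd_or_bl => //; apply: inZ_cl; rewrite eq_sym.
  right; have [zp|zp] := boolP (inZ p); [left|right].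
    move=> y; rewrite mem_cat => /orP[yw|yw] ty.
      by rewrite (cf_uz cf yw) zp in ty.
    by apply: rx; rewrite // mem_cat yw.
  move=> y; rewrite mem_cat => /orP[yw|yw] ty.
    by apply: rx; rewrite // mem_cat yw orbT.
  by rewrite (negPf (cf_wd cf yw)) (negPf zp) in ty.
left; have cf' : config (p :: P') uz ud wz wd by rewrite -EP.
exact: (end_blue cf' xin yin bx bY).
Qed.

End Rigid.

Definition anchored (uz ud wz wd : seq T) (t : T) : Prop :=
  red_to (uz ++ ud) t /\ not_red_to (wz ++ wd) t.

Lemma not_red_or_has s t :
  not_red_to s t \/ exists x, [/\ x \in s, inZ x != inZ t & rd t x].
Proof.
have [/hasP[x xin /andP[tx rx]]|nh] := boolP (has (fun x => (inZ x != inZ t) && rd t x) s).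
  by right; exists x.
left=> x xin tx; apply: contra nh => rx; apply/hasP; exists x => //.
by rewrite tx.
Qed.

(** A red edge from one end to the other half would let one half be absorbed at each end of [P]. *)
Lemma anchored_same_half P uz ud wz wd p q :
  rigid P uz ud wz wd -> chain rd P p q ->
  red_to (uz ++ ud) p -> red_to (uz ++ ud) q ->
  two_paths \/ (anchored uz ud wz wd p /\ anchored uz ud wz wd q).
Proof.
move=> rg ch rp rq.
have [up upU tup] := opposite_in_half rg p; have [uq uqU tuq] := opposite_in_half rg q.
have [np|[w [win tw rw]]] := not_red_or_has (wz ++ wd) p; last first.
  by left; apply: (rigid_both_ends rg ch uqU (rq _ uqU tuq) win rw).
have [nq|[w [win tw rw]]] := not_red_or_has (wz ++ wd) q; last first.
  by left; apply: (rigid_both_ends (rigid_rev rg) (chain_rev rd_sym ch) upU (rp _ upU tup) win rw).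
by right.
Qed.

(** Ends that are red to different halves absorb one half each, so both may be assumed to be red to
    the same half. *)
Lemma anchored_ends P uz ud wz wd p q :
  rigid P uz ud wz wd -> chain rd P p q ->
  [\/ two_paths, anchored uz ud wz wd p /\ anchored uz ud wz wd q
    | anchored wz wd uz ud p /\ anchored wz wd uz ud q].
Proof.
move=> rg ch; have chr := chain_rev rd_sym ch.
have [P1 [EP _ _]] := ch; have [P2 [EP2 _ _]] := chr.
have opp (t : T) := opposite_in_half rg t; have oppW (t : T) := opposite_in_half (rigid_swap rg) t.
have [?|[rp|rp]] := end_red_to rg EP; first exact: Or31.
all: have [?|[rq|rq]] := end_red_to (rigid_rev rg) EP2; first exact: Or31.
- by have [?|?] := anchored_same_half rg ch rp rq; [exact: Or31|exact: Or32].
- have [u uin tu] := opp p; have [w win tw] := oppW q; apply: Or31.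
  exact: (rigid_both_ends (rigid_rev rg) chr uin (rp _ uin tu) win (rq _ win tw)).
- have [u uin tu] := opp q; have [w win tw] := oppW p; apply: Or31.
  exact: (rigid_both_ends rg ch uin (rq _ uin tu) win (rp _ win tw)).
- by have [?|?] := anchored_same_half (rigid_swap rg) ch rp rq; [exact: Or31|exact: Or33].
Qed.

(** The red edge from [u] to [w] chains both halves behind [q]. To leave the first half at [u] in
    [ud], the path has to enter it in [uz]. *)
Lemma linked_anchored P uz ud wz wd p q u w :
  rigid P uz ud wz wd -> chain rd P p q -> anchored uz ud wz wd q ->
  u \in ud -> w \in wd -> rd u w -> two_paths.
Proof.
move=> rg ch [rq nq] uu ww ruw; have cf := rg_cf rg.
have [s1 s2 s3 s4] := rigid_sizes rg.
have cov : perm_eq (P ++ uz ++ ud ++ wd ++ wz) V.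
  by rewrite -(permPr (cf_cover cf)); apply/permP=> a; count_lia.
have [zq|zq] := boolP (inZ q); last first.
  have [x xu] := pick_mem s1.
  refine (absorb_through_link rd_sym bl_sym cov (cf_blz cf) (cf_bld cf)
    (rigid_rdU rg) (rigid_rdW rg) _ s1 s2 s4 s3 _ xu uu ww ruw).
    by rewrite /close_sizes (cf_sz cf) (cf_sd cf); slia.
  right; exists p, q; split=> //; apply: rq; first by rewrite mem_cat xu.
  by rewrite (cf_uz cf xu) (negPf zq).
(* A vertex [q] of the class [z0] cannot enter [uz], but it can join it: like the vertices of [uz]
   it is red to [ud] and blue to [wd]. It then is the entry vertex itself, and [close_sizes]
   tolerates the extra vertex. *)
have [P1 EP] : exists P1, P = rcons P1 q.
  case: ch => v [-> _ <-]; exists (belast p v); exact: lastI.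
have cov1 : perm_eq (P1 ++ (q :: uz) ++ ud ++ wd ++ wz) V.
  rewrite -(permPr cov) EP; apply/permP=> a.
  by rewrite -cats1; count_lia.
have bl1 : complete bl (q :: uz) wd.
  move=> x y; rewrite inE => /orP[/eqP->|xu] yw; last exact: cf_blz cf _ _ xu yw.
  have ty : inZ y != inZ q by rewrite zq (negPf (cf_wd cf yw)).
  apply: rd_or_bl; first by apply: inZ_cl; rewrite eq_sym.
  by apply: nq; rewrite // mem_cat yw orbT.
have rd1 : complete rd (q :: uz) ud.
  move=> x y; rewrite inE => /orP[/eqP->|xu] yw; last exact: (rigid_rdU rg).
  by apply: rq; rewrite ?mem_cat ?yw ?orbT // zq (negPf (cf_ud cf yw)).
refine (absorb_through_link rd_sym bl_sym cov1 bl1 (cf_bld cf)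
    rd1 (rigid_rdW rg) _ isT s2 s4 s3 _ (mem_head _ _) uu ww ruw).
  by rewrite /close_sizes /= (cf_sz cf) (cf_sd cf); slia.
case: P1 EP {cov1} => [|x P1] EP; [by left|right].
exists x, (last x P1); have := cf_path cf; rewrite EP /= rcons_path => /andP[pP rl].
by split=> //; exists P1.
Qed.

(** In the rigid case [u] and [w] are joined in red, which supplies the link between the halves. *)
Lemma config_linked P uz ud wz wd u w :
  config P uz ud wz wd -> u \in ud -> w \in wd -> cl u != cl w -> two_paths.
Proof.
move=> cf uu ww ne; have [//|rg] := config_rigid cf.
have ruw := rigid_link rg uu ww ne.
case: P cf rg => [|p P] cf rg.
  have [s1 s2 s3 s4] := rigid_sizes rg; have [x xu] := pick_mem s1.
  refine (absorb_through_link rd_sym bl_sym (P := [::]) _ (cf_blz cf) (cf_bld cf)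
    (rigid_rdU rg) (rigid_rdW rg) _ s1 s2 s4 s3 (or_introl erefl) xu uu ww ruw).
    by rewrite -(permPr (cf_cover cf)); apply/permP=> a; count_lia.
  by rewrite /close_sizes (cf_sz cf) (cf_sd cf); slia.
have ch := sorted_chain (cf_path cf).
have [//|[_ aq]|[_ aq]] := anchored_ends rg ch.
  exact: linked_anchored rg ch aq uu ww ruw.
by apply: (linked_anchored (rigid_swap rg) ch aq ww uu); rewrite rd_sym.
Qed.
(** For three classes and [c] different from [z0], the vertices of the third class. *)
Definition other (c : nat) (x : T) : bool := ~~ inZ x && (cl x != c).

(** Since [p] is not in class [c], it is adjacent to every [w] in [wd]. If the edge is red, one half
    is absorbed at each end; if it is blue, [p] links the bicliques, being blue to [wz] as well. *)
Lemma end_other P uz ud wz wd p q c :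
  rigid P uz ud wz wd -> chain rd P p q -> {in wd, forall x, cl x = c} ->
  anchored uz ud wz wd p -> anchored uz ud wz wd q -> other c p -> two_paths.
Proof.
move=> rg ch clD [rp np] [rq nq] /andP[zp cp]; have cf := rg_cf rg.
have [_ _ s3 s4] := rigid_sizes rg.
have [w ww] := pick_mem s4; have [y yw] := pick_mem s3.
have [rw|nrw] := boolP (rd p w).
  have [u uin tu] := opposite_in_half rg q.
  by apply: (rigid_both_ends rg ch uin (rq _ uin tu) _ rw); rewrite mem_cat ww orbT.
have [P' [EP _ _]] := ch; rewrite EP in cf.
apply: (end_blue cf (x := w) (y := y)); rewrite ?mem_cat ?ww ?yw ?orbT //.
  by apply: rd_or_bl nrw; rewrite (clD _ ww).
have ty : inZ y != inZ p by rewrite (cf_wz cf yw) (negPf zp).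
apply: rd_or_bl; first by apply: inZ_cl; rewrite eq_sym.
by apply: np; rewrite // mem_cat yw.
Qed.

(** * Rotating the red path through the half formed by [uz] and [ud] *)

Section Rotation.
Variables (p p2 : T) (P uz ud wz wd : seq T) (q : T) (c : nat).
Hypothesis rg : rigid [:: p, p2 & P] uz ud wz wd.
Hypothesis ch : chain rd [:: p, p2 & P] p q.
Hypothesis clW : {in wd, forall x, cl x = c}.
Hypotheses (anp : anchored uz ud wz wd p) (anq : anchored uz ud wz wd q).
Hypothesis np : ~~ other c p.

Lemma anchored_bl t x : anchored uz ud wz wd t -> x \in wz ++ wd ->
  inZ x != inZ t -> bl t x.
Proof.
case=> _ nt xin tx; apply: rd_or_bl; last exact: nt.
by apply: inZ_cl; rewrite eq_sym.
Qed.

Lemma rd_p_p2 : rd p p2.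
Proof. by have := cf_path (rg_cf rg) => /= /andP[]. Qed.

Lemma chain_tail : chain rd (p2 :: P) p2 q.
Proof. by case: ch => _ [[<-]] /= /andP[_ pP] <-; exists P. Qed.

(** [p] joins [uz] or [ud], whose vertices it resembles in its red and blue edges. Then [p2] is an
    end that is red to the other half, and each half is absorbed at one end. *)
Lemma second_red w : w \in wz ++ wd -> rd p2 w -> two_paths.
Proof.
move=> win rw; have cf := rg_cf rg; have [rp _] := anp; have [rq _] := anq.
have [u uin tu] := opposite_in_half rg q; have ruq := rq _ uin tu.
have [s1 s2 s3 s4] := rigid_sizes rg; have := cf_cover cf => cov.
have win' : w \in wd ++ wz by rewrite mem_cat orbC -mem_cat.
have [zp|zp] := boolP (inZ p).
  refine (absorb_both_ends rd_sym bl_sym (a1 := p :: uz) (b1 := ud) _ _ (cf_bld cf) _ (rigid_rdW rg)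
    _ isT s2 s4 s3 chain_tail _ ruq win' rw).
  - by rewrite -(permPr cov); apply/permP=> a; count_lia.
  - move=> x y; rewrite inE => /orP[/eqP->|xu] yw; last exact: cf_blz cf _ _ xu yw.
    apply: anchored_bl => //; first by rewrite mem_cat yw orbT.
    by rewrite zp (negPf (cf_wd cf yw)).
  - move=> x y; rewrite inE => /orP[/eqP->|xu] yw; last exact: (rigid_rdU rg).
    by apply: rp; rewrite ?mem_cat ?yw ?orbT // zp (negPf (cf_ud cf yw)).
  - by rewrite /close_sizes /= (cf_sz cf) (cf_sd cf); slia.
  - by rewrite inE uin orbT.
refine (absorb_both_ends rd_sym bl_sym (a1 := uz) (b1 := p :: ud) _ (cf_blz cf) _ _ (rigid_rdW rg)
    _ s1 isT s4 s3 chain_tail _ ruq win' rw).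
- by rewrite -(permPr cov); apply/permP=> a; count_lia.
- move=> x y; rewrite inE => /orP[/eqP->|xu] yw; last exact: cf_bld cf _ _ xu yw.
  apply: anchored_bl => //; first by rewrite mem_cat yw.
  by rewrite (negPf zp) (cf_wz cf yw).
- move=> x y xu; rewrite inE => /orP[/eqP->|yu]; last exact: (rigid_rdU rg).
  by rewrite rd_sym; apply: rp; rewrite ?mem_cat ?xu // (negPf zp) (cf_uz cf xu).
- by rewrite /close_sizes /= (cf_sz cf) (cf_sd cf); slia.
- by move: uin; rewrite !mem_cat !inE => /orP[]->; rewrite ?orbT.
Qed.

Hypothesis p2_not_red : {in wz ++ wd, forall w, ~~ rd p2 w}.

(* Two consecutive vertices [p], [p2] outside the class [z0] lie in different
   classes, so [p2] is blue to both blue bicliques and joins them. *)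
Lemma second_joins : ~~ inZ p -> ~~ inZ p2 -> P != [::] -> two_paths.
Proof.
move=> zp zp2 nP; have cf := rg_cf rg; have [s1 s2 s3 s4] := rigid_sizes rg.
have cp : cl p = c by apply/eqP; move: np; rewrite /other zp negbK.
have cp2 : cl p2 != c by rewrite -cp eq_sym; apply: rd_cl; apply: rd_p_p2.
have bz : {in wz, forall y, bl p2 y}.
  move=> y yw; apply: rd_or_bl; last by apply: p2_not_red; rewrite mem_cat yw.
  by apply: inZ_cl; rewrite (negPf zp2) (cf_wz cf yw).
have bd : {in wd, forall y, bl p2 y}.
  move=> y yw; apply: rd_or_bl; last by apply: p2_not_red; rewrite mem_cat yw orbT.
  by rewrite (clW yw).
have [d du] := pick_mem s2; have [z zu] := pick_mem s1.
have [w ww] := pick_mem s4; have [y yw] := pick_mem s3.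
have [p3 [P3 EP]] : exists p3 P3, P = p3 :: P3 by case: (P) nP => // p3 P3; exists p3, P3.
have chP : chain rd P p3 q.
  by have [_ [[<-]]] := chain_tail; rewrite EP /= => /andP[_ pP] <-; exists P3.
(* [p] replaces [d] in [ud], while [d] is appended behind [q], preceded by [z] if [q] lies outside
   the class [z0]. The blue paths [v1] and [v2] are joined by [p2]. *)
have pud := perm_to_rem du; have puz := perm_to_rem zu.
have := (perm_size pud, perm_size puz) => /= -[sud suz].
have sz := cf_sz cf; have sd := cf_sd cf.
have c2 : complete bl wz (p :: rem d ud).
  apply: completeC => // a b; rewrite inE => /orP[/eqP->|/mem_rem au] bw.
    by apply: anchored_bl => //; rewrite ?mem_cat ?bw // (negPf zp) (cf_wz cf bw).
  exact: cf_bld cf _ _ au bw.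
have [v2 [y2 [ch2 pv2]]] := balanced_chain_from bl_sym c2 ltac:(rewrite /=; slia)
  (x := y) ltac:(by rewrite mem_cat yw).
have ch2' := chain_cons (bz _ yw) ch2; have [rq _] := anq.
have [zq|zq] := boolP (inZ q).
  have [v1 ch1 pv1] := balanced_chain bl_sym (cf_blz cf) sz zu ww.
  exists (P ++ [:: d]), (v1 ++ p2 :: v2); split.
  - rewrite -(permPr (cf_cover cf)); apply/permP=> a.
    move: (permP pud a) (permP pv1 a) (permP pv2 a); count_lia.
  - apply: (chain_sorted (chain_cat chP (chain1 rd d) _)).
    by apply: rq; rewrite ?mem_cat ?du ?orbT // zq (negPf (cf_ud cf du)).
  - by apply: (chain_sorted (chain_cat ch1 ch2' _)); rewrite bl_sym bd.
have c1 : complete bl wd (rem z uz).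
  by apply: completeC => // a b /mem_rem au bw; apply: cf_blz cf _ _ au bw.
have [v1 [y1 [ch1 pv1]]] := odd_chain_from bl_sym c1 ltac:(slia) ww.
exists (P ++ [:: z; d]), (rev v1 ++ p2 :: v2); split.
- rewrite -(permPr (cf_cover cf)); apply/permP=> a.
  move: (permP pud a) (permP puz a) (permP pv1 a) (permP pv2 a).
  count_lia.
- apply: (chain_sorted (chain_cat chP (chain_cons _ (chain1 rd d)) _)).
    exact: rigid_rdU rg _ _ zu du.
  by apply: rq; rewrite ?mem_cat ?zu // (negPf zq) (cf_uz cf zu).
- by apply: (chain_sorted (chain_cat (chain_rev bl_sym ch1) ch2' _)); rewrite bl_sym bd.
Qed.

(** [p] and [p2] take the places of [z] and [d], which are appended behind [q] in the order that the
    side of [q] dictates. The configuration keeps its shape while the red path moves on by two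
    vertices. *)
Lemma rotate : inZ p != inZ p2 -> P != [::] ->
  exists pz pd s z d, [/\ (pz \in [:: p; p2]) && (pd \in [:: p; p2]), perm_eq s [:: z; d],
    config (P ++ s) (pz :: rem z uz) (pd :: rem d ud) wz wd, z \in uz & d \in ud].
Proof.
move=> tp nP; have cf := rg_cf rg; have [s1 s2 s3 s4] := rigid_sizes rg.
have [d du] := pick_mem s2; have [z zu] := pick_mem s1.
have pud := perm_to_rem du; have puz := perm_to_rem zu.
have := (perm_size pud, perm_size puz) => /= -[sud suz].
have sz := cf_sz cf; have sd := cf_sd cf; have [rq _] := anq.
have [p3 [P3 EP]] : exists p3 P3, P = p3 :: P3 by case: (P) nP => // p3 P3; exists p3, P3.
have chP : chain rd P p3 q.
  by have [_ [[<-]]] := chain_tail; rewrite EP /= => /andP[_ pP] <-; exists P3.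
have blP t x : t \in [:: p; p2] -> x \in wz ++ wd -> inZ x != inZ t -> bl t x.
  rewrite !inE => /orP[]/eqP-> xin tx; first exact: anchored_bl.
  by apply: rd_or_bl; [apply: inZ_cl; rewrite eq_sym|apply: p2_not_red].
have [pz [pd [ppd zz zd]]] : exists pz pd, [/\ perm_eq [:: pz; pd] [:: p; p2], inZ pz & ~~ inZ pd].
  have [zp|zp] := boolP (inZ p); [exists p, p2|exists p2, p]; rewrite ?perm_refl //; split=> //.
  - by move: tp; rewrite zp; case: (inZ p2).
  - by apply/permP=> a; count_lia.
  - by move: tp; rewrite (negPf zp); case: (inZ p2).
have pzin : pz \in [:: p; p2] by rewrite -(perm_mem ppd) mem_head.
have pdin : pd \in [:: p; p2] by rewrite -(perm_mem ppd) !inE eqxx orbT.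
have [s ps sPs] : exists2 s, perm_eq s [:: z; d] & sorted rd (P ++ s).
  have rzd := rigid_rdU rg zu du.
  have [zq|zq] := boolP (inZ q).
    exists [:: d; z]; first by apply/permP=> a; count_lia.
    apply: (chain_sorted (chain_cat chP (chain_cons _ (chain1 rd z)) _)).
      by rewrite rd_sym.
    by apply: rq; rewrite ?mem_cat ?du ?orbT // zq (negPf (cf_ud cf du)).
  exists [:: z; d]; first exact: perm_refl.
  apply: (chain_sorted (chain_cat chP (chain_cons rzd (chain1 rd d)) _)).
  by apply: rq; rewrite ?mem_cat ?zu // (negPf zq) (cf_uz cf zu).
exists pz, pd, s, z, d; split=> //; first by rewrite pzin pdin.
split=> //.
- rewrite -(permPr (cf_cover cf)); apply/permP=> a.
  move: (permP pud a) (permP puz a) (permP ps a) (permP ppd a).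
  by count_lia.
- by move=> x; rewrite inE => /orP[/eqP-> //|/mem_rem]; apply: cf_uz cf _.
- by move=> x; rewrite inE => /orP[/eqP-> //|/mem_rem]; apply: cf_ud cf _.
- exact: cf_wz cf.
- exact: cf_wd cf.
- by rewrite /=; slia.
- by rewrite /=; slia.
- move=> x y; rewrite inE => /orP[/eqP->|/mem_rem xu] yw; last exact: cf_blz cf _ _ xu yw.
  by apply: blP; rewrite ?mem_cat ?yw ?orbT // zz (negPf (cf_wd cf yw)).
- move=> x y; rewrite inE => /orP[/eqP->|/mem_rem xu] yw; last exact: cf_bld cf _ _ xu yw.
  by apply: blP; rewrite ?mem_cat ?yw // (negPf zd) (cf_wz cf yw).
Qed.

End Rotation.

(** Induction on the position of the first [other] vertex of [P]: each rotation brings it two places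
    closer to the front, where [end_other] applies. *)
Lemma config_uniform n c P uz ud wz wd :
  config P uz ud wz wd -> {in ud, forall x, cl x = c} -> {in wd, forall x, cl x = c} ->
  has (other c) P -> find (other c) P < n -> two_paths.
Proof.
elim: n P uz ud wz wd => // n IHn P uz ud wz wd cf clU clW hP fP.
have [//|rg] := config_rigid cf.
case: P cf rg hP fP => // p P cf rg hP fP.
have ch := sorted_chain (cf_path cf); set q := last p P in ch.
wlog [ap aq] : uz ud wz wd cf rg clU clW /
    anchored uz ud wz wd p /\ anchored uz ud wz wd q.
  move=> WL; have [//|an|an] := anchored_ends rg ch; first exact: (WL uz ud wz wd).
  by apply: (WL wz wd uz ud) => //; [apply: config_swap|apply: rigid_swap].
have [op|np] := boolP (other c p); first exact: (end_other rg ch clW ap aq op).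
have [oq|nq] := boolP (other c q).
  exact: (end_other (rigid_rev rg) (chain_rev rd_sym ch) clW aq ap oq).
have hP' : has (other c) P by move: hP; rewrite /= (negPf np).
case: P @q cf rg hP hP' fP ch aq nq => // p2 P q cf rg hP hP' fP ch aq nq.
have nP : P != [::].
  by apply: contraNneq nq => EP; move: hP'; rewrite /q EP /= orbF.
have [/hasP[w win rw]|] := boolP (has (rd p2) (wz ++ wd)).
  exact: (second_red rg ch ap aq win rw).
move/hasPn=> nr2.
(* Red neighbours lie in different classes, so on the same side of [z0] both lie outside it. *)
have [tp|/negPn/eqP tp] := boolP (inZ p != inZ p2); last first.
  have zp : ~~ inZ p.
    apply/negP=> zp; have := rd_cl (rd_p_p2 rg).
    have zp2 : inZ p2 by rewrite -tp.
    by rewrite (eqP zp) (eqP zp2) eqxx.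
  by apply: (second_joins rg ch clW ap aq np) => //; rewrite -tp.
have [pz [pd [s [z [d [/andP[pzin pdin] ps cf' zu du]]]]]] := rotate rg ch ap aq nr2 tp nP.
have [w ww] : exists w, w \in wd by have [_ _ _] := rigid_sizes rg; apply: pick_mem.
(* A vertex of another class that is rotated into [ud] links the halves; otherwise [ud] stays inside
   class [c]. *)
have [cpd|cpd] := eqVneq (cl pd) c; last first.
  by apply: (config_linked cf' (mem_head _ _) ww); rewrite (clW _ ww).
have no2 : ~~ other c p2.
  have zd := cf_ud cf' (mem_head _ _).
  move: pdin; rewrite !inE => /orP[]/eqP Epd; last by rewrite /other -Epd cpd eqxx andbF.
  by move: tp; rewrite -Epd (negPf zd) /other; case: (inZ p2).
have hPP : has (other c) P by move: hP'; rewrite /= (negPf no2).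
apply: (IHn _ _ _ _ _ cf') => //.
- by move=> x; rewrite inE => /orP[/eqP-> //|/mem_rem]; apply: clU.
- by rewrite has_cat hPP.
- by move: fP; rewrite find_cat hPP /= (negPf np) (negPf no2); slia.
Qed.

(** Either some vertices of [ud] and [wd] differ in class and are linked, or all of them share a
    class [c]; then [x] or [y] is outside [c] and has to lie on [P]. *)
Lemma config_two_paths P uz ud wz wd :
  config P uz ud wz wd ->
  (exists x y, [/\ x \in V, y \in V, ~~ inZ x, ~~ inZ y & cl x != cl y]) -> two_paths.
Proof.
move=> cf [x [y [xV yV zx zy nxy]]]; have [//|rg] := config_rigid cf.
have [_ s2 _ s4] := rigid_sizes rg.
have [u uu] := pick_mem s2; have [w ww] := pick_mem s4.
have [/hasP[u1 u1u /hasP[w1 w1w ne]]|nl] :=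
  boolP (has (fun u => has (fun w => cl u != cl w) wd) ud).
  exact: (config_linked cf u1u w1w ne).
have eqc u1 w1 : u1 \in ud -> w1 \in wd -> cl u1 = cl w1.
  move=> u1u w1w; apply/eqP; apply: contraR nl => ne.
  by apply/hasP; exists u1 => //; apply/hasP; exists w1.
pose c := cl w; have clU : {in ud, forall x, cl x = c} by move=> v vu; apply: eqc.
have clW : {in wd, forall x, cl x = c} by move=> v vw; rewrite -(eqc u v) // (eqc u w).
have inP v : v \in V -> other c v -> v \in P.
  rewrite -(perm_mem (cf_cover cf)) !mem_cat => vin /andP[zv cv].
  case/or4P: vin => // [/(cf_uz cf)|/clU|/orP[/(cf_wz cf)|/clW]].
  - by rewrite (negPf zv).
  - by move/eqP; rewrite (negPf cv).
  - by rewrite (negPf zv).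
  - by move/eqP; rewrite (negPf cv).
have hP : has (other c) P.
  apply/hasP; have [Ex|nx] := eqVneq (cl x) c.
    have oy : other c y by rewrite /other zy -Ex eq_sym.
    by exists y => //; apply: inP.
  have ox : other c x by rewrite /other zx.
  by exists x => //; apply: inP.
exact: (config_uniform cf clU clW hP (leqnn _)).
Qed.

End Configurations.

(** * The red exploration *)

Section Endings.
Variables (T : eqType) (V : seq T) (cl : T -> nat) (rd bl : rel T).
Hypotheses (rd_sym : symmetric rd) (bl_sym : symmetric bl).
Hypothesis rd_cl : forall x y, rd x y -> cl x != cl y.
Hypothesis rd_or_bl : forall x y, cl x != cl y -> ~~ rd x y -> bl x y.
Variables (P L : seq T).
Hypotheses (coverV : perm_eq (P ++ L) V) (sortedP : sorted rd P).

Lemma three_label_ending (side : pred T) (lab : T -> nat) :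
  2 * count side L = size L -> {in L, forall x, lab x < 3} ->
  (forall i, 2 * count (fun x => lab x == i) L < size L) ->
  {in L &, forall x y, side x -> ~~ side y -> lab x != lab y -> bl x y} ->
  two_paths V rd bl.
Proof.
move=> half lab3 few blL.
pose xs := [seq x <- L | side x]; pose ys := [seq x <- L | predC side x].
have pL a : count a xs + count a ys = count a L.
  have /permP/(_ a) : perm_eq (xs ++ ys) L by apply/permPl/perm_filterC.
  by rewrite count_cat.
have memL x : x \in xs ++ ys -> x \in L.
  by rewrite mem_cat !mem_filter => /orP[]/andP[].
have Exs : size xs = count side L by rewrite size_filter.
have Exy := pL predT; rewrite !count_predT in Exy.
have [|||b sb pb] := three_label_path bl_sym (xs := xs) (ys := ys) (lab := lab) ltac:(slia).
- by move=> x /memL /lab3.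
- by move=> i; rewrite count_cat pL; have := few i; slia.
- move=> x y; rewrite !mem_filter => /andP[sx xL] /andP[sy yL]; exact: blL.
exists P, b; split=> //; rewrite -(permPr coverV); apply/permP=> a.
by move: (permP pb a) (pL a); count_lia.
Qed.

(** Crossing the halves with the class [z0] gives the four blocks of a [config]; since both splits
    are exact, diagonally opposite blocks have equal sizes. *)
Lemma halves_ending z0 (U : pred T) :
  2 * count U L = size L -> 2 * count (inZ cl z0) L = size L ->
  {in L &, forall x y, U x -> ~~ U y -> inZ cl z0 x != inZ cl z0 y -> ~~ rd x y} ->
  (exists x y, [/\ x \in V, y \in V, ~~ inZ cl z0 x, ~~ inZ cl z0 y & cl x != cl y]) ->
  two_paths V rd bl.
Proof.
move=> halfU halfZ nrd ex; pose Z := inZ cl z0.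
pose uz := [seq x <- L | U x && Z x]; pose ud := [seq x <- L | U x && ~~ Z x].
pose wz := [seq x <- L | ~~ U x && Z x]; pose wd := [seq x <- L | ~~ U x && ~~ Z x].
have pL a : count a L = count a uz + count a ud + count a wz + count a wd.
  by rewrite /uz /ud /wz /wd; elim: (L) => //= x s ->; case: (U x); case: (Z x); rewrite /=; slia.
have sU : count U L = size uz + size ud.
  by rewrite /uz /ud; elim: (L) => //= x s ->; case: (U x); case: (Z x); rewrite /=; slia.
have sZ : count Z L = size uz + size wz.
  by rewrite /uz /wz; elim: (L) => //= x s ->; case: (U x); case: (Z x); rewrite /=; slia.
have sL := pL predT; rewrite !count_predT in sL; rewrite -/Z in halfZ.
have blUW x y : x \in L -> y \in L -> U x -> ~~ U y -> Z x != Z y -> bl x y.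
  move=> xL yL Ux Uy Zxy; apply: rd_or_bl; last exact: nrd.
  exact: inZ_cl Zxy.
apply: (config_two_paths rd_sym bl_sym rd_cl rd_or_bl (z0 := z0)
  (P := P) (uz := uz) (ud := ud) (wz := wz) (wd := wd)) => //.
split=> //.
- by rewrite -(permPr coverV); apply/permP=> a; move: (pL a); count_lia.
- by move=> x; rewrite mem_filter => /andP[/andP[]].
- by move=> x; rewrite mem_filter => /andP[/andP[]].
- by move=> x; rewrite mem_filter => /andP[/andP[]].
- by move=> x; rewrite mem_filter => /andP[/andP[]].
- by slia.
- by slia.
- move=> x y; rewrite !mem_filter => /andP[/andP[Ux Zx] xL] /andP[/andP[Uy Zy] yL].
  by apply: blUW; rewrite // Zx (negPf Zy).
- move=> x y; rewrite !mem_filter => /andP[/andP[Ux Zx] xL] /andP[/andP[Uy Zy] yL].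
  by apply: blUW; rewrite // Zy (negPf Zx).
Qed.

End Endings.

Section RedExploration.
Variables (T : finType) (cl : T -> nat) (rd bl : rel T).
Hypotheses (rd_sym : symmetric rd) (bl_sym : symmetric bl).
Hypothesis rd_cl : forall x y, rd x y -> cl x != cl y.
Hypothesis rd_or_bl : forall x y, cl x != cl y -> ~~ rd x y -> bl x y.
Hypothesis cl_lt3 : forall x, cl x < 3.
Hypothesis cl_onto : forall i, i < 3 -> exists x, cl x = i.
Local Notation two_paths := (two_paths (enum T) rd bl).
Implicit Types (P : seq T) (R W X : {set T}).

Definition rest P : {set T} := [set x | x \notin P].

Definition cnt (a : pred T) R : nat := #|[set x in R | a x]|.

Lemma count_enum (a : pred T) R : count a (enum R) = cnt a R.
Proof.
rewrite /cnt cardE -size_filter; apply/perm_size/uniq_perm.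
- exact/filter_uniq/enum_uniq.
- exact: enum_uniq.
- by move=> x; rewrite mem_filter !mem_enum !inE andbC.
Qed.

Lemma size_enum R : size (enum R) = #|R|.
Proof. by rewrite cardE. Qed.

Lemma perm_rest P : uniq P -> perm_eq (P ++ enum (rest P)) (enum T).
Proof.
move=> uP; apply: uniq_perm; last 1 first.
- by move=> x; rewrite mem_cat !mem_enum !inE; case: (x \in P).
- rewrite cat_uniq uP enum_uniq andbT /=; apply/hasPn=> x.
  by rewrite mem_enum inE.
- exact: enum_uniq.
Qed.

Lemma cnt_predC (a : pred T) R : cnt a R + cnt (predC a) R = #|R|.
Proof.
rewrite -!count_enum -size_enum; exact: count_predC.
Qed.

Lemma cnt_rem (a : pred T) R z : z \in R -> cnt a R = a z + cnt a (R :\ z).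
Proof.
move=> zR; rewrite /cnt (cardsD1 z) !inE zR /=; congr (_ + _).
by apply: eq_card => x; rewrite !inE andbA.
Qed.

Lemma rest_rcons P z : rest (rcons P z) = rest P :\ z.
Proof. by apply/setP=> x; rewrite !inE mem_rcons inE negb_or. Qed.

Lemma rest_cons P z : rest (z :: P) = rest P :\ z.
Proof. by apply/setP=> x; rewrite !inE negb_or. Qed.

Lemma rest_rev P : rest (rev P) = rest P.
Proof. by apply/setP=> x; rewrite !inE mem_rev. Qed.

Lemma sorted_rcons2 P z z' :
  sorted rd (rcons P z) -> rd z z' -> sorted rd (rcons (rcons P z) z').
Proof.
by case: P => [|x P] /=; rewrite ?andbT // => pP rz; rewrite rcons_path pP last_rcons.
Qed.

Lemma sorted_rcons_cat P z s :
  sorted rd (rcons P z) -> path rd z s -> sorted rd (rcons P z ++ s).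
Proof. by case: P => [|x P] //= pP ps; rewrite cat_path pP last_rcons. Qed.

Lemma full_halves P : uniq P -> sorted rd P -> halved rd (rest P) ->
  (forall i, 2 * cnt (fun x => cl x == i) (rest P) < #|rest P|) -> two_paths.
Proof.
move=> uP sP [U /closed_inP[sU clU] half] few.
apply: (three_label_ending bl_sym (perm_rest uP) sP (side := mem U) (lab := cl)).
- rewrite count_enum size_enum -half; congr (2 * _).
  by apply: eq_card => x; rewrite inE; apply: andb_idl; apply: (subsetP sU).
- by move=> x _; apply: cl_lt3.
- by move=> i; rewrite count_enum size_enum.
- move=> x y; rewrite !mem_enum => xR yR xU yU ne.
  by apply: rd_or_bl ne _; apply: clU.
Qed.

(** * A class with exactly half of the uncovered vertices *)

Section TightClass.
Variable z0 : nat.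
Local Notation Z := (inZ cl z0).

(** Only the components of these edges matter for a tight class, whereas the red path itself may use
    all red edges. *)
Definition zd : rel T := fun x y => rd x y && (Z x != Z y).

Lemma zd_sym : symmetric zd.
Proof. by move=> x y; rewrite /zd rd_sym eq_sym. Qed.

Lemma two_other_classes :
  exists x y, [/\ x \in enum T, y \in enum T, ~~ Z x, ~~ Z y & cl x != cl y].
Proof.
have [i [j [i3 j3 iz jz ij]]] : exists i j, [/\ i < 3, j < 3, i != z0, j != z0 & i != j].
  by case: z0 => [|[|z]]; [exists 1, 2|exists 0, 2|exists 0, 1].
have [x cx] := cl_onto i3; have [y cy] := cl_onto j3.
by exists x, y; rewrite !mem_enum /inZ cx cy.
Qed.

Lemma balanced_halves P : uniq P -> sorted rd P -> halved zd (rest P) ->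
  2 * cnt Z (rest P) = #|rest P| -> two_paths.
Proof.
move=> uP sP [U /closed_inP[sU clU] half] bal.
apply: (halves_ending rd_sym bl_sym rd_cl rd_or_bl (perm_rest uP) sP
  (z0 := z0) (U := mem U)) two_other_classes.
- rewrite count_enum size_enum -half; congr (2 * _).
  by apply: eq_card => x; rewrite inE; apply: andb_idl; apply: (subsetP sU).
- by rewrite count_enum size_enum.
- move=> x y; rewrite !mem_enum => xR yR xU yU Zxy.
  by have := clU x y xU yR yU; rewrite /zd Zxy andbT.
Qed.

Definition cntD R : nat := cnt (predC Z) R.

Lemma cntZ_cntD R : cnt Z R + cntD R = #|R|.
Proof. exact: cnt_predC. Qed.

Lemma cntD_rem R z : z \in R -> cntD R = ~~ Z z + cntD (R :\ z).
Proof. exact: cnt_rem. Qed.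

(** [z] is about to be appended, and its side of [z0] has as many vertices in [R] as the other side
    or one more. Once [z] is removed, the same holds for a successor on the other side. *)
Definition ahead (z : T) R : bool :=
  if Z z then cntD R <= cnt Z R <= (cntD R).+1
  else cnt Z R <= cntD R <= (cnt Z R).+1.

Lemma balanced_ahead z R : 2 * cnt Z R = #|R| -> ahead z R.
Proof. by rewrite -(cntZ_cntD R) /ahead; case: (Z z); slia. Qed.

Lemma alternating_exploration n P W X z :
  #|rest P| <= n -> uniq P -> sorted rd (rcons P z) -> state zd (rest P) W X ->
  z \in X -> ahead z (rest P) -> two_paths.
Proof.
elim: n P W X z => [|n IHn] P W X z leR uP sPz st zX ah.
  by have := state_lt st; slia.
have /closed_inP[sXR _] := state_X st; have zR := subsetP sXR z zX.
have uPz : uniq (rcons P z) by rewrite rcons_uniq uP andbT; move: zR; rewrite inE.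
have c1 := cnt_rem Z zR; have c2 := cntD_rem zR.
have cR := cntZ_cntD (rest P :\ z).
have cR1 : #|rest P| = #|rest P :\ z|.+1 by rewrite (cardsD1 z) zR.
have [hv|[W' [X' [st' sX' [z' z'X' ezz']]]]] := state_step zd_sym st zX.
  rewrite -rest_rcons in hv cR c1 c2; apply: (balanced_halves uPz sPz hv).
  (* By [half] the remaining set has even size, so an imbalance of at most one is none. *)
  case: hv => U _ half; move: ah; rewrite /ahead.
  by case: (Z z) c1 c2 => /= c1 c2; slia.
have [rzz' tz] := andP ezz'.
apply: (IHn (rcons P z) W' X' z') => //; rewrite ?rest_rcons //; first by slia.
  exact: sorted_rcons2.
move: ah; rewrite /ahead; move: tz c1 c2 => /=.
by case: (Z z); case: (Z z') => //= _ c1 c2; slia.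
Qed.

Lemma big_state R X :
  closed_in zd R X -> connected_set zd X -> #|R| < 2 * #|X| -> state zd R set0 X.
Proof.
move=> cX coX big; split=> //; rewrite ?closed_in0 ?cards0 //.
  by rewrite -setI_eq0 set0I.
have [X0 _] := coX; have /closed_inP[/subset_leq_card sX _] := cX.
by move: X0; rewrite -card_gt0; slia.
Qed.

Lemma big_exploration P X z : uniq P -> sorted rd (rcons P z) ->
  closed_in zd (rest P) X -> connected_set zd X -> #|rest P| < 2 * #|X| ->
  z \in X -> ahead z (rest P) -> two_paths.
Proof.
move=> uP sPz cX coX big; apply: (alternating_exploration (leqnn _) uP sPz).
exact: (big_state cX coX big).
Qed.

Lemma closed_in_setU1 R X x : closed_in zd R X -> {in X, forall y, ~~ zd x y} ->
  closed_in zd (x |: R) X.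
Proof.
case/closed_inP=> sX cX nx; apply/closed_inP; split.
  exact: subset_trans sX (subsetUr _ _).
move=> a b aX; rewrite !inE => /orP[/eqP->|bR] bX; last exact: cX.
by rewrite zd_sym nx.
Qed.

Lemma rest_behead x P : uniq (x :: P) -> rest P = x |: rest (x :: P).
Proof.
by move=> /= /andP[xP _]; rewrite rest_cons setD1K // inE.
Qed.

(** Every edge of [zd] meets the class [z0], so a connected set outside it is a single vertex. *)
Lemma connected_has_Z X : connected_set zd X -> 1 < #|X| -> exists2 x, x \in X & Z x.
Proof.
move=> [X0 coX] X1; apply/exists_inP; apply: contraLR X1 => /exists_inPn nZ.
have [x xX] := set0Pn _ X0; rewrite -(coX [set x]) ?cards1 //.
  by apply/set0Pn; exists x; rewrite inE.
apply/closed_inP; split; first by rewrite sub1set.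
move=> a b; rewrite inE => /eqP-> bX _.
by rewrite /zd (negPf (nZ _ xX)) (negPf (nZ _ bX)) eqxx andbF.
Qed.

(* The excess of the window [P] outside the class [z0] stays what it has to be
   while [P] slides along a red path towards the large component [X]. *)
Lemma slide n P k x X :
  2 * size k + size P < n -> uniq (P ++ k) -> sorted rd (P ++ rcons k x) ->
  x \in X -> {in k, forall y, y \notin X} ->
  closed_in zd (rest P) X -> connected_set zd X -> #|rest P| < 2 * #|X| ->
  2 * cnt Z (rest P) = #|rest P| -> two_paths.
Proof.
elim: n P k => // n IHn P k len uPk sPk xX nk cX coX big bal.
have uP : uniq P by move: uPk; rewrite cat_uniq => /and3P[].
have /closed_inP[sXR clX] := cX.
case: k => [|m k] in len uPk sPk nk *.
  by rewrite cats1 in sPk; apply: (big_exploration uP sPk cX coX big xX (balanced_ahead _ bal)).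
case: P => [|a P] in len uPk sPk cX big bal uP sXR clX *.
  exact: (big_exploration (P := [::]) (z := x) isT isT cX coX big xX (balanced_ahead _ bal)).
set Q := a :: P in len uPk sPk cX big bal uP sXR clX *.
have mR : m \in rest Q.
  by rewrite inE; move: uPk; rewrite cat_uniq /= => /and3P[_ /norP[]].
have mX := nk m (mem_head _ _).
have cm := cnt_rem Z mR; have cm' := cntD_rem mR.
have cQ := cntZ_cntD (rest Q).
have cQ1 : #|rest Q| = #|rest Q :\ m|.+1 by rewrite (cardsD1 m) mR.
have cX1 : closed_in zd (rest (rcons Q m)) X.
  apply: (closed_in_sub cX); rewrite rest_rcons ?subsetDl // subsetD1 sXR mX //.
have sQm : sorted rd (rcons Q m ++ rcons k x) by rewrite cat_rcons.
have uQm : uniq (rcons Q m ++ k) by rewrite cat_rcons.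
have uQm' : uniq (rcons Q m) by move: uQm; rewrite cat_uniq => /and3P[].
have nk' : {in k, forall y, y \notin X} by move=> y yk; apply: nk; rewrite inE yk orbT.
(* The successor of an [m] in [z0] lies outside [z0]: it is either [x], for which the imbalance
   after [m] is what [ahead] allows, or [m2], which restores the balance. *)
have [Zm|Zm] := boolP (Z m).
  case: k => [|m2 k] in len uPk sPk nk sQm uQm nk' *.
    have Zx : ~~ Z x.
      have rmx : rd m x by move: sQm; rewrite cats1 /= !rcons_path last_rcons => /andP[_].
      by apply: contraNN (rd_cl rmx) => Zx; rewrite (eqP Zm) (eqP Zx).
    rewrite cats1 in sQm; apply: (big_exploration uQm' sQm cX1 coX _ xX).
      by rewrite rest_rcons; slia.
    by rewrite /ahead rest_rcons (negPf Zx); move: cm cm'; rewrite /= Zm /=; slia.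
  have m2R : m2 \in rest (rcons Q m).
    by rewrite inE; move: uQm; rewrite cat_uniq /= => /and3P[_ /norP[]].
  have Zm2 : ~~ Z m2.
    have rmm : rd m m2.
      by move: sQm; rewrite /= cat_path last_rcons /= => /and3P[].
    by apply: contraNN (rd_cl rmm) => Zx; rewrite (eqP Zm) (eqP Zx).
  have dm := cnt_rem Z m2R; have dQ1 : #|rest (rcons Q m)| = #|rest (rcons Q m) :\ m2|.+1.
    by rewrite (cardsD1 m2) m2R.
  apply: (IHn (rcons (rcons Q m) m2) k) => //.
  - by move: len; rewrite !size_rcons /=; slia.
  - by rewrite cat_rcons.
  - by rewrite cat_rcons.
  - by move=> y yk; apply: nk'; rewrite inE yk orbT.
  - apply: (closed_in_sub cX1); rewrite (rest_rcons (rcons _ _)) ?subsetDl // subsetD1.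
    have /closed_inP[-> _] := cX1.
    by apply: nk'; rewrite mem_head.
  - by rewrite rest_rcons; move: dQ1; rewrite rest_rcons; slia.
  - move: dm dQ1; rewrite !rest_rcons (negPf Zm2) => dm dQ1.
    by move: cm; rewrite Zm /=; slia.
(* Reversed, the window ends in [a] and may enter [X] from there; if it cannot, [a] may be dropped
   and [X] stays closed. *)
have rsort y : rd a y -> sorted rd (rcons (rev Q) y).
  move=> ray; have sQ : sorted rd Q.
    by move: sPk; rewrite /= cat_path => /andP[].
  have := chain_cat (chain_rev rd_sym (sorted_chain sQ)) (chain1 rd y) ray.
  by rewrite cats1; apply: chain_sorted.
have [/exists_inP[y yX ray]|/exists_inPn nay] := boolP [exists y in X, rd a y].
  apply: (big_exploration (P := rev Q) (X := X) (z := y)) => //; rewrite ?rev_uniq ?rest_rev //.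
    exact: rsort.
  exact: balanced_ahead.
have nza : {in X, forall y, ~~ zd a y} by move=> y /nay; rewrite /zd => /negPf->.
have EQ := rest_behead uP; have cX2 := closed_in_setU1 cX nza; rewrite -EQ in cX2.
have aR : a \in rest P by rewrite EQ !inE eqxx.
have ca := cnt_rem Z aR; have cR : #|rest P| = #|rest Q|.+1.
  by rewrite (cardsD1 a) aR -rest_cons.
rewrite -rest_cons -/Q in ca.
have uP' : uniq P by case/andP: uP.
(* Outside [z0], [a] can be exchanged for [m] without changing the balance. *)
have [Za|Za] := boolP (Z a); last first.
  have mP : m \in rest P by rewrite EQ inE mR orbT.
  have dm := cnt_rem Z mP; have dR : #|rest P| = #|rest P :\ m|.+1.
    by rewrite (cardsD1 m) mP.
  apply: (IHn (rcons P m) k) => //.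
  - by move: len; rewrite size_rcons /=; slia.
  - by case/andP: uQm.
  - by move: sQm => /=; apply: path_sorted.
  - apply: (closed_in_sub cX2); rewrite rest_rcons ?subsetDl // subsetD1 mX andbT.
    by have /closed_inP[] := cX2.
  - by rewrite rest_rcons; slia.
  - by rewrite rest_rcons; move: dm ca; rewrite (negPf Zm) (negPf Za); slia.
have cPC := cntZ_cntD (rest P).
(* If the window is [a] alone, dropping it puts the class [z0] ahead by one, and the search starts
   afresh at a vertex of [z0] in [X]; by parity [X] still has more than half. *)
case: P => [|b P] in Q len uPk sPk cX big bal uP sXR clX mR cm cm' cQ cQ1 cX1 sQm uQm
    uQm' rsort EQ cX2 aR ca cR uP' cPC *.
  have [y yX Zy] := connected_has_Z coX ltac:(slia).
  apply: (big_exploration (P := [::]) (X := X) (z := y)) => //; first by slia.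
  by rewrite /ahead Zy; move: ca; rewrite Za; slia.
have rab : rd a b by move: sPk => /= /andP[].
have Zb : ~~ Z b.
  by apply: contraNN (rd_cl rab) => Zb; rewrite (eqP Za) (eqP Zb).
(* Without [a], the reversed window ends in [b] and may enter [X] at a vertex of [z0]. If this
   fails, [b] is dropped too, which restores the balance. *)
have [/exists_inP[y yX /andP[rby Zy]]|/exists_inPn nby] := boolP [exists y in X, rd b y && Z y].
  apply: (big_exploration (P := rev (b :: P)) (X := X) (z := y)) => //;
    rewrite ?rev_uniq ?rest_rev //; last 2 first.
  - by slia.
  - by rewrite /ahead Zy; move: ca; rewrite Za; slia.
  have sQ : sorted rd (b :: P) by move: sPk; rewrite /= cat_path => /and3P[].
  have := chain_cat (chain_rev rd_sym (sorted_chain sQ)) (chain1 rd y) rby.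
  by rewrite cats1; apply: chain_sorted.
have nzb : {in X, forall y, ~~ zd b y}.
  move=> y /nby; rewrite /zd (negPf Zb) negb_and => /orP[/negPf->//|/negPf->].
  by rewrite eqxx andbF.
have EP := rest_behead uP'; have cX3 := closed_in_setU1 cX2 nzb; rewrite -EP in cX3.
have bR : b \in rest P by rewrite EP !inE eqxx.
have cb := cnt_rem Z bR; have cR' : #|rest P| = #|rest (b :: P)|.+1.
  by rewrite (cardsD1 b) bR -rest_cons.
rewrite -rest_cons in cb.
have balP : 2 * cnt Z (rest P) = #|rest P|.
  by move: ca cb; rewrite Za (negPf Zb); slia.
have sPk' : sorted rd (P ++ rcons (m :: k) x).
  by move: sPk => /= /andP[_]; apply: path_sorted.
have uP2 : uniq P by case/andP: uP'.
(* Two vertices came back to an even set, so [X] still has at least half; if it has exactly half, it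
   is one of two halves. *)
have [big'|small] := ltnP #|rest P| (2 * #|X|).
  apply: (IHn P (m :: k)) => //; first by move: len; rewrite /=; slia.
  by move: uPk => /= /and3P[_ _].
apply: (balanced_halves uP2 _ _ balP).
  by move: sPk'; case: (P) => //= p0 P0; rewrite cat_path => /andP[].
by exists X => //; slia.
Qed.

(** A component [X] with more than half is reached by sliding; one with exactly half is itself a
    half. If it has less, then [W], [X] and the remainder serve as three labels, each below half
    because [W :|: X] exceeds half, and edges across [z0] between different labels are blue. *)
Lemma tight_class P :
  uniq P -> sorted rd P -> 2 * cnt Z (rest P) = #|rest P| ->
  (forall X, closed_in zd (rest P) X -> connected_set zd X -> #|rest P| < 2 * #|X| ->
     exists k x, [/\ uniq (P ++ k), sorted rd (P ++ rcons k x), x \in X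
                   & {in k, forall y, y \notin X}]) ->
  two_paths.
Proof.
move=> uP sP bal reach.
have [hv|[W [X st]]] := halved_or_initial zd_sym (rest P).
  exact: (balanced_halves uP sP hv bal).
case: (st) => cW cX coX dWX ltW gtX.
have [small|big|eqX] := ltngtP (2 * #|X|) #|rest P|; last first.
- by apply: (balanced_halves uP sP _ bal); exists X.
- have [k [x [uPk sPk xX nk]]] := reach X cX coX big.
  exact: (slide (leqnn _) uPk sPk xX nk cX coX big bal).
pose lab x := if x \in W then 0 else if x \in X then 1 else 2.
have /closed_inP[sW clW] := cW; have /closed_inP[sX clX] := cX.
have few i : 2 * cnt (fun x => lab x == i) (rest P) < #|rest P|.
  have cW' : cnt (fun x => lab x == 0) (rest P) <= #|W|.
    apply: subset_leq_card; apply/subsetP=> x; rewrite inE /lab => /andP[_].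
    by case: ifP => // _; case: ifP.
  have cX' : cnt (fun x => lab x == 1) (rest P) <= #|X|.
    apply: subset_leq_card; apply/subsetP=> x; rewrite inE /lab => /andP[_].
    by case: ifP => // _; case: ifP.
  have c2 : cnt (fun x => lab x == 2) (rest P) + #|W :|: X| <= #|rest P|.
    have d2 : [disjoint [set x in rest P | lab x == 2] & W :|: X].
      rewrite -setI_eq0; apply/eqP/setP=> x; rewrite !inE /lab.
      by case: (x \in W); case: (x \in X); rewrite ?andbF.
    have := leq_card_setU [set x in rest P | lab x == 2] (W :|: X) => -[_].
    rewrite d2 => /eqP <-; apply: subset_leq_card.
    by rewrite !subUset sW sX !andbT; apply/subsetP=> x; rewrite inE => /andP[].
  have cWX : #|W :|: X| = #|W| + #|X| by apply/eqP; rewrite (leq_card_setU W X).2.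
  case: i => [|[|[|i]]]; [by slia|by slia|by slia|].
  have -> : cnt (fun x => lab x == i.+3) (rest P) = 0.
    apply/eqP; rewrite cards_eq0; apply/eqP/setP=> x; rewrite !inE /lab.
    by case: ifP; rewrite ?andbF //; case: ifP; rewrite ?andbF.
  by slia.
apply: (three_label_ending bl_sym (perm_rest uP) sP (side := Z) (lab := lab)).
- by rewrite count_enum size_enum.
- by move=> x _; rewrite /lab; case: ifP => //; case: ifP.
- by move=> i; rewrite count_enum size_enum; apply: few.
- move=> x y; rewrite !mem_enum => xR yR Zx Zy; rewrite /lab => lxy.
  have tz : Z x != Z y by rewrite Zx (negPf Zy).
  apply: rd_or_bl; first exact: inZ_cl tz.
  have zdE : ~~ zd x y -> ~~ rd x y by rewrite /zd tz andbT.
  apply: zdE; move: lxy; have [xW|xW] := boolP (x \in W).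
    by have [//|yW _] := boolP (y \in W); apply: clW.
  have [yW _|yW] := boolP (y \in W); first by rewrite zd_sym clW.
  have [xX|xX] := boolP (x \in X); first by have [//|yX _] := boolP (y \in X); apply: clX.
  by have [yX _|//] := boolP (y \in X); rewrite zd_sym clX.
Qed.

(** [X] fits neither into [W] nor into the part outside [W :|: Q], so it lies in the red component
    [Q]. Connectivity of [Q] gives a red path from [y], cut off where it first meets [X]. *)
Lemma red_path_to_component P y Q W X :
  uniq (rcons P y) -> sorted rd (rcons P y) -> state rd (rest P) W Q -> y \in Q ->
  closed_in zd (rest (rcons P y)) X -> connected_set zd X ->
  #|rest (rcons P y)| < 2 * #|X| ->
  exists k x, [/\ uniq (rcons P y ++ k), sorted rd (rcons P y ++ rcons k x), x \in X
                & {in k, forall z, z \notin X}].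
Proof.
move=> uP sP st yQ cX [X0 coX] big; set R := rest (rcons P y) in cX big *.
case: (st) => cW cQ [_ coQ] dWQ ltW gtQ.
have ER : R = rest P :\ y by rewrite /R rest_rcons.
have sRP : R \subset rest P by rewrite ER subsetDl.
have /closed_inP[sXR _] := cX; have sXP := subset_trans sXR sRP.
have /closed_inP[sQP clQ] := cQ; have yP := subsetP sQP y yQ.
have cardR : #|rest P| = #|R|.+1 by rewrite (cardsD1 y) yP ER.
have zd_closed S : closed_in rd (rest P) S -> closed_in zd (rest P) S.
  case/closed_inP=> sS cS; apply/closed_inP; split=> // a b aS bP bS.
  by rewrite /zd (negPf (cS a b aS bP bS)).
(* A red-closed set contains [X] or misses it; [X] has more than half of [R], which is only one
   vertex short of [rest P]. *)
have avoid S : closed_in rd (rest P) S -> 2 * #|S| < #|rest P| -> S :&: X = set0.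
  move=> /zd_closed cS ltS; apply: contraTeq ltS => SX0.
  have ESX := coX _ SX0 (closed_in_setI cS sXP).
  have : #|X| <= #|S| by rewrite -ESX subset_leq_card // subsetIl.
  by slia.
have cWQ : closed_in rd (rest P) (W :|: Q) by apply: closed_inU.
have cO : closed_in rd (rest P) (rest P :\: (W :|: Q)).
  by apply: closed_inD => //; apply: closed_inT.
have cardWQ : #|W :|: Q| = #|W| + #|Q| by apply/eqP; rewrite (leq_card_setU W Q).2.
have /closed_inP[sWQ _] := cWQ.
have cardO : #|rest P :\: (W :|: Q)| + #|W :|: Q| = #|rest P|.
  by rewrite cardsD (setIidPr sWQ) subnK // subset_leq_card.
have aW := avoid _ cW ltW; have aO := avoid _ cO ltac:(slia).
have sXQ : X \subset Q.
  apply/subsetP=> x xX; apply/negPn/negP=> xQ.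
  have [xW|xW] := boolP (x \in W).
    by move/setP/(_ x): aW; rewrite !inE xW xX.
  have := subsetP sXP x xX; rewrite inE => xP.
  by move/setP/(_ x): aO; rewrite !inE xX (negPf xW) (negPf xQ) xP.
(* Steps have to land in [R], so that the path avoids [P] and [y]. *)
pose g : rel T := fun a b => rd a b && (b \in R).
have [x0 x0X yx0] : exists2 x, x \in X & connect g y x.
  have [/exists_inP//|/exists_inPn nX] := boolP [exists x in X, connect g y x].
  pose B := Q :\: [set z | connect g y z].
  have sXB : X \subset B.
    by apply/subsetP=> x xX; rewrite !inE (subsetP sXQ) // andbT nX.
  have B0 : B != set0 by apply: contraNneq X0 => B0; rewrite -subset0 -B0.
  have cB : closed_in rd Q B.
    apply/closed_inP; split=> [|a b]; first exact: subsetDl.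
    rewrite !inE => /andP[na aQ] bQ; rewrite bQ andbT negbK => yb.
    apply: contra (na) => rab; apply: connect_trans yb (connect1 _).
    rewrite /g rd_sym rab ER in_setD1 (subsetP sQP) // andbT.
    by apply: contraNneq na => ->; apply: connect0.
  by have := yQ; rewrite -(coQ _ B0 cB) !inE connect0.
have [p0 pp Ex0] := connectP yx0; rewrite Ex0 in x0X.
case/shortenP: pp x0X => p pp up _ x0X.
have yX : y \notin X by apply/negP=> /(subsetP sXR); rewrite ER !inE eqxx.
have hX : has (mem X) p.
  apply/hasP; exists (last y p) => //; case: (p) x0X yX => [|a s] /=; first by move=> ->.
  by rewrite mem_last.
case: (split_find hX) pp up => x k p' xX nk pp up.
have : path g y (rcons k x) by move: pp; rewrite cat_path => /andP[].
move=> pk; have pr : path rd y (rcons k x) by apply: sub_path pk => a b /andP[].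
have kR : {subset rcons k x <= R}.
  suff gR s b : path g b s -> {subset s <= R} by apply: gR pk.
  elim: s b => //= a s IHs b /andP[/andP[_ aR] ps] z.
  by rewrite inE => /orP[/eqP->|/(IHs _ ps)].
exists k, x; split=> //.
- rewrite cat_uniq uP /=; apply/andP; split.
    apply/hasPn=> z zk; have := kR z; rewrite mem_rcons inE zk orbT => /(_ isT).
    by rewrite inE.
  by move: up => /= /andP[_]; rewrite cat_uniq rcons_uniq => /andP[/andP[]].
- exact: sorted_rcons_cat.
- by move=> z zk; apply: (hasPn nk).
Qed.

End TightClass.

(** The search runs while no class is tight. Appending [z] lowers the total by one, so a class
    strictly below half reaches at most half: it is then tight, or the invariant persists. *)
Lemma full_exploration n P W X z :
  #|rest P| <= n -> uniq P -> sorted rd (rcons P z) -> state rd (rest P) W X -> z \in X ->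
  (forall i, 2 * cnt (fun x => cl x == i) (rest P) < #|rest P|) -> two_paths.
Proof.
elim: n P W X z => [|n IHn] P W X z leR uP sPz st zX few.
  by have := state_lt st; slia.
have /closed_inP[sXR _] := state_X st; have zR := subsetP sXR z zX.
have uPz : uniq (rcons P z) by rewrite rcons_uniq uP andbT; move: zR; rewrite inE.
have cR : #|rest P| = #|rest (rcons P z)|.+1 by rewrite rest_rcons (cardsD1 z) zR.
have le i : 2 * cnt (fun x => cl x == i) (rest (rcons P z)) <= #|rest (rcons P z)|.
  by have := cnt_rem (fun x => cl x == i) zR; rewrite -rest_rcons; have := few i; slia.
have [/existsP[i /eqP tight]|/existsPn ntight] := boolP
  [exists i : 'I_3, 2 * cnt (fun x => cl x == i) (rest (rcons P z)) == #|rest (rcons P z)|].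
  apply: (tight_class (z0 := i) uPz sPz tight) => Y cY coY bigY.
  exact: (red_path_to_component uPz sPz st zX cY coY bigY).
(* An empty remainder would make every class tight. *)
have R0 : 0 < #|rest (rcons P z)|.
  have := ntight (inord 0); rewrite inordK // lt0n; apply: contraNneq => R0.
  by rewrite R0; have := le 0; rewrite R0; slia.
have few' i : 2 * cnt (fun x => cl x == i) (rest (rcons P z)) < #|rest (rcons P z)|.
  have [i3|i3] := ltnP i 3.
    by have := ntight (Ordinal i3); rewrite ltn_neqAle le andbT.
  have -> : cnt (fun x => cl x == i) (rest (rcons P z)) = 0; last by rewrite muln0.
  apply/eqP; rewrite cards_eq0; apply/eqP/setP=> x; rewrite !inE.
  by apply/andP=> -[_ /eqP ci]; have := cl_lt3 x; rewrite ci; slia.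
have [hv|[W' [X' [st' sX' [z' z'X' rzz']]]]] := state_step rd_sym st zX.
  by rewrite -rest_rcons in hv; apply: (full_halves uPz sPz hv few').
apply: (IHn (rcons P z) W' X' z') => //; rewrite ?rest_rcons //; last exact: sorted_rcons2.
by rewrite -rest_rcons; slia.
Qed.

Lemma tripartite_two_paths :
  (forall i, 2 * cnt (fun x => cl x == i) [set: T] <= #|T|) -> two_paths.
Proof.
have ET : rest [::] = [set: T] by apply/setP=> x; rewrite !inE.
rewrite -cardsT -ET => le.
have [/existsP[i /eqP tight]|/existsPn ntight] := boolP
  [exists i : 'I_3, 2 * cnt (fun x => cl x == i) (rest [::]) == #|rest [::]|].
  (* The red path is still empty, so any vertex of [X] can be entered directly. *)
  apply: (tight_class (P := [::]) (z0 := i) isT isT tight) => X _ [/set0Pn[x xX] _] _.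
  by exists [::], x.
have few i : 2 * cnt (fun x => cl x == i) (rest [::]) < #|rest [::]|.
  have [i3|i3] := ltnP i 3.
    by have := ntight (Ordinal i3); rewrite ltn_neqAle le andbT.
  have -> : cnt (fun x => cl x == i) (rest [::]) = 0.
    apply/eqP; rewrite cards_eq0; apply/eqP/setP=> x; rewrite !inE.
    by apply/andP=> -[_ /eqP ci]; have := cl_lt3 x; rewrite ci; slia.
  by rewrite muln0 ET cardsT; have [x _] := cl_onto (isT : 0 < 3); apply/card_gt0P; exists x.
have [hv|[W [X st]]] := halved_or_initial rd_sym (rest [::]).
  exact: (full_halves (P := [::]) isT isT hv few).
have [/set0Pn[z zX] _] := state_conn st.
exact: (full_exploration (P := [::]) (leqnn _) isT isT st zX few).
Qed.

End RedExploration.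

(** * Merging classes down to three *)

(** Of two disjoint pairs of classes, at least one has at most half of the vertices and can be
    merged. *)
Lemma merge_classes (T : finType) n (cl : T -> nat) :
  (forall x, cl x < n.+3) -> (forall i, i < n.+3 -> exists x, cl x = i) ->
  (forall i, 2 * cnt (fun x => cl x == i) [set: T] <= #|T|) ->
  exists cl' : T -> nat, [/\ forall x, cl' x < 3, forall i, i < 3 -> exists x, cl' x = i,
    forall i, 2 * cnt (fun x => cl' x == i) [set: T] <= #|T|
    & forall x y, cl' x != cl' y -> cl x != cl y].
Proof.
elim: n cl => [|n IHn] cl lt onto fair; first by exists cl.
have step (f : nat -> nat) : (forall i, i < n.+4 -> f i < n.+3) ->
    (forall i, i < n.+3 -> exists2 j, j < n.+4 & f j = i) ->
    (forall i, 2 * cnt (fun x => f (cl x) == i) [set: T] <= #|T|) ->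
    exists cl' : T -> nat, [/\ forall x, cl' x < 3, forall i, i < 3 -> exists x, cl' x = i,
      forall i, 2 * cnt (fun x => cl' x == i) [set: T] <= #|T|
      & forall x y, cl' x != cl' y -> cl x != cl y].
  move=> flt fonto ffair.
  have [||//|cl' [lt' onto' fair' coarse]] := IHn (fun x => f (cl x)).
  - by move=> x; apply: flt.
  - by move=> i /fonto[j /onto[x cx] fj]; exists x; rewrite cx.
  exists cl'; split=> // x y /coarse; apply: contraNneq => -> //.
have cntU (a b c : pred T) : (forall x, c x -> a x || b x) ->
    cnt c [set: T] <= cnt a [set: T] + cnt b [set: T].
  move=> abc; rewrite /cnt; apply: leq_trans (leq_card_setU _ _).1.
  by apply: subset_leq_card; apply/subsetP=> x; rewrite !inE /= => /abc.
have cnt_sub (a b : pred T) : (forall x, a x -> b x) -> cnt a [set: T] <= cnt b [set: T].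
  by move=> ab; apply: subset_leq_card; apply/subsetP=> x; rewrite !inE /= => /ab.
pose C i := cnt (fun x => cl x == i) [set: T].
have total : C 0 + C n.+3 + (C 1 + C 2) <= #|T|.
  have disj2 i j : i != j -> C i + C j = cnt (fun x => (cl x == i) || (cl x == j)) [set: T].
    move=> ij; rewrite /C /cnt.
    have := leq_card_setU [set x in [set: T] | cl x == i] [set x in [set: T] | cl x == j] => -[_].
    have -> : [disjoint [set x in [set: T] | cl x == i] & [set x in [set: T] | cl x == j]].
      rewrite -setI_eq0; apply/eqP/setP=> x; rewrite !inE /=.
      by apply/andP=> -[/eqP->]; rewrite (negPf ij).
    move/eqP <-; apply: eq_card => x; by rewrite !inE /=.
  rewrite (disj2 0 n.+3) // (disj2 1 2) //.
  rewrite -[leqRHS]cardsT -(cnt_predC (fun x => (cl x == 0) || (cl x == n.+3)) [set: T]).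
  rewrite leq_add2l; apply: cnt_sub => x /=.
  by case/orP=> /eqP->; rewrite /= ?orbF.
have [le|gt] := leqP (2 * (C 0 + C n.+3)) #|T|.
  apply: (step (fun i => if i == n.+3 then 0 else i)).
  - by move=> i; case: eqP => // /eqP; slia.
  - by move=> i i3; exists i; [slia|case: eqP => //; slia].
  - move=> i; case: i => [|i].
      apply: leq_trans le; rewrite leq_mul2l /=; apply: cntU => x.
      by case: (cl x == n.+3); rewrite ?orbT // orbF.
    apply: leq_trans (fair i.+1); rewrite leq_mul2l /=; apply: cnt_sub => x.
    by case: (cl x == n.+3).
(* Classes 1 and 2 are merged, and the last class takes over the free index 2. *)
apply: (step (fun i => if i == 2 then 1 else if i == n.+3 then 2 else i)).
- by move=> i; case: eqP => // _; case: eqP => // /eqP; slia.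
- move=> i i3; have [->|i2] := eqVneq i 2; first by exists n.+3; rewrite ?eqxx //; case: eqP.
  by exists i; [slia|rewrite (negPf i2); case: eqP => //; slia].
- move=> i; case: i => [|[|[|i]]].
  + apply: leq_trans (fair 0); rewrite leq_mul2l /=; apply: cnt_sub => x.
    by case: (cl x == 2); case: (cl x == n.+3).
  + apply: (@leq_trans (2 * (C 1 + C 2))); last by slia.
    rewrite leq_mul2l /=; apply: cntU => x.
    by case: (cl x == 2); case: (cl x == n.+3); rewrite ?orbT // => ->.
  + apply: leq_trans (fair n.+3); rewrite leq_mul2l /=; apply: cnt_sub => x.
    by have [//|nx] := eqVneq (cl x) 2; case: (cl x == n.+3) => //; rewrite (negPf nx).
  + apply: leq_trans (fair i.+3); rewrite leq_mul2l /=; apply: cnt_sub => x.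
    by case: (cl x == 2); case: (cl x == n.+3).
Qed.

(** * From three classes back to [k] *)

Theorem theorem1p4 (T : finType) (k : nat) (part : T -> 'I_k)
    (col : T -> T -> bool) :
  3 <= k ->
  classes_nonempty part ->
  fair part ->
  (forall x y, col x y = col y x) ->
  exists r b : seq T,
    [/\ mono_col_path (cmp_adj part) col true r,
        mono_col_path (cmp_adj part) col false b,
        uniq (r ++ b) &
        forall v : T, v \in r ++ b].
Proof.
case: k part => [|[|[|n]]] // part _ onto fair col_sym.
have [cl [lt3 onto3 fair3 coarse]] : exists cl : T -> nat,
    [/\ forall x, cl x < 3, forall i, i < 3 -> exists x, cl x = i,
    forall i, 2 * cnt (fun x => cl x == i) [set: T] <= #|T|
    & forall x y, cl x != cl y -> part x != part y].
  apply: (merge_classes (cl := fun x => part x)) => [x|i ik|i]; first exact: ltn_ord.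
    by have [x px] := onto (Ordinal ik); exists x; rewrite px.
  have [ik|ik] := ltnP i n.+3.
    apply: leq_trans (fair (Ordinal ik)); rewrite leq_mul2l /=.
    by apply: subset_leq_card; apply/subsetP=> x; rewrite !inE.
  rewrite (_ : cnt _ _ = 0) ?muln0 //; apply/eqP; rewrite cards_eq0.
  apply/eqP/setP=> x; rewrite !inE; apply/eqP=> px.
  by have := ltn_ord (part x); rewrite px ltnNge ik.
(* Edges inside a merged class are discarded; by [coarse] the remaining ones are edges of the
   original graph. *)
pose rd x y := (cl x != cl y) && col x y; pose bl x y := (cl x != cl y) && ~~ col x y.
have rd_sym : symmetric rd by move=> x y; rewrite /rd eq_sym col_sym.
have bl_sym : symmetric bl by move=> x y; rewrite /bl eq_sym col_sym.
have rd_cl x y : rd x y -> cl x != cl y by case/andP.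
have rd_or_bl x y : cl x != cl y -> ~~ rd x y -> bl x y by rewrite /rd /bl => ->.
have [r [b [prb sr sb]]] := tripartite_two_paths rd_sym bl_sym rd_cl rd_or_bl lt3 onto3 fair3.
have urb : uniq (r ++ b) by rewrite (perm_uniq prb) enum_uniq.
have /and3P[ur _ ub] : [&& uniq r, ~~ has (mem r) b & uniq b] by rewrite -cat_uniq.
exists r, b; split=> //.
- rewrite /mono_col_path ur; apply: sub_sorted sr => x y /andP[/coarse pxy ->].
  by rewrite /cmp_adj pxy.
- rewrite /mono_col_path ub; apply: sub_sorted sb => x y /andP[/coarse pxy /negPf->].
  by rewrite /cmp_adj pxy.
- by move=> v; rewrite (perm_mem prb) mem_enum.
Qed.
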